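(* Let $q\in k$ be generic. For every transposition, i.e. every invertible $U_q(sl(2))$-covariant linear operator $\overline S:V\otimes V'\to V'\otimes V$, let $T^*(S^2_q)=T^*(S^2_q)_{\overline S}$ be the $A$-bimodule obtained from the two-sided module $\overline{T^*(S^2_q)}$ by imposing the permutation rule given by $\overline S$ (all objects are defined in the context). Then the canonical surjective homomorphism of right $A$-modules $$T^*_r(S^2_q)\longrightarrow T^*(S^2_q)_{\overline S},\qquad [v'\otimes a]\mapsto [1\otimes v'\otimes a],$$ is not injective, i.e. $T^*(S^2_q)_{\overline S}$ is a proper quotient of the right cotangent module $T^*_r(S^2_q)$. Consequently there is no transposition $\overline S$ for which the bimodule $T^*(S^2_q)_{\overline S}$ is a flat deformation of the classical cotangent bimodule $T^*(S^2)$ (the case $q=1$ with $\overline S$ the flip).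
   Context: $k=\mathbb R$ or $\mathbb C$. ''Generic $q$'' means $q$ outside an at most countable set of exceptional values containing $0$ and the roots of unity. Let $V$ be the three-dimensional (spin 1) $U_q(sl(2))$-module with basis $u,v,w$ and action $Xu=0,\ Xv=-(q+q^{-1})u,\ Xw=v$; $Yu=-v,\ Yv=(q+q^{-1})w,\ Yw=0$; $Hu=2u,\ Hv=0,\ Hw=-2w$. Then $V^{\otimes 2}=V_0\oplus V_1\oplus V_2$ with $V_i$ the irreducible spin $i$ submodule (tensor signs omitted): $V_0=\mathrm{span}(v_0)$, $v_0=(q^3+q)uw+v^2+(q+q^{-1})wu$; $V_1=\mathrm{span}(q^2uv-vu,\ (q^3+q)(uw-wu)+(1-q^2)v^2,\ wv-q^2vw)$; $V_2=\mathrm{span}(u^2,\ uv+q^2vu,\ uw-qv^2+q^4wu,\ vw+q^2wv,\ w^2)$. Quantum sphere: $A=k(S^2_q)=T(V)/\{V_1,\ v_0-c\}$, where $T(V)$ is the free tensor algebra, $\{I\}$ is the two-sided ideal generated by $I$, and $c\in k$, $c\neq0$, is fixed. For $q=1$ this is the commutative algebra $k(S^2)$. $V'$ is a copy of the $U_q(sl(2))$-module $V$ with basis $du,dv,dw$. Using $V'\cong V$ one identifies $V\otimes V'$ and $V'\otimes V$ with $V\otimes V$; $(V\otimes V')_i$ and $(V'\otimes V)_i$ denote the spin $i$ components. A $U_q(sl(2))$-covariant operator $\overline S:V\otimes V'\to V'\otimes V$ is one of the form $xP_0+yP_1+zP_2$ with $x,y,z\in k$, where $P_i:V\otimes V'\to(V'\otimes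 V)_i$ become the projectors $V^{\otimes2}\to V_i$ under these identifications; it is invertible iff $x,y,z\ne0$. Let $\mu$ be the product of $A$ and $\mu^{ij}$ the product applied to the $i$-th and $j$-th tensor factors. Put $M_r=\mu^{23}((V'\otimes V)_0\otimes A)\subset V'\otimes A$ and $M_l=\mu^{12}(A\otimes (V\otimes V')_0)\subset A\otimes V'$. The right cotangent module is $T^*_r(S^2_q)=(V'\otimes A)/M_r$, and $$\overline{T^*(S^2_q)}=(A\otimes V'\otimes A)/(M_l\otimes A+A\otimes M_r).$$ For a transposition $\overline S$, $T^*(S^2_q)_{\overline S}$ is the quotient of $\overline{T^*(S^2_q)}$ by the sub-bimodule generated by the classes of all $a\otimes v'\otimes 1-1\otimes\overline S(a\otimes v')$, $a\in V$, $v'\in V'$, where $\overline S(a\otimes v')\in V'\otimes V$ is regarded as an element of $V'\otimes A$. The classical cotangent bimodule $T^*(S^2)$ is the same quotient at $q=1$ with $\overline S$ the flip $a\otimes v'\mapsto v'\otimes a$; in that case the canonical map from the right cotangent module is an isomorphism. Flat deformation: a deformation $V_\hbar$ of a vector space $V$ ($\hbar$ a formal parameter, here $q=e^{\hbar}$) is flat if $V_\hbar/\hbar V_\hbar=V$ and $V_\hbar\cong V\otimes k[[\hbar]]$ as $k[[\hbar]]$-modules (completed tensor product). *)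

(* Defs.v *)
From HB Require Import structures.
From mathcomp Require Import all_boot all_algebra.
From mathcomp Require Import boolp classical_sets cardinality reals complex.
From mathcomp Require Import finmap.
From mathcomp.multinomials Require Import monalg.

Set Implicit Arguments.
Unset Strict Implicit.
Unset Printing Implicit Defensive.

Import GRing.Theory.
Local Open Scope quotient_scope.
Local Open Scope classical_set_scope.
Local Open Scope ring_scope.

(* A module with operators is a module M with a family op of endomorphisms.  *)
(* A plain module is the case Om = void, a right A-module the case Om = A    *)
(* and an A-bimodule the case Om = A + A.                                    *)
Section Quotient.
Context {R : nzRingType} {M : lmodType R} {Om : Type}.
Variables (op : Om -> {linear M -> M}) (G : set M).

Definition op_submodule (N : set M) : Prop :=
  [/\ N 0, forall a x y, N x -> N y -> N (a *: x + y)
         & forall o x, N x -> N (op o x)].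

Definition op_span : set M := smallest op_submodule G.

Lemma op_span_submodule : op_submodule op_span.
Proof.
split=> [N [[]] // | a x y Nx Ny N NP | o x Nx N NP].
  by case: (NP) => -[_ ND _] _; apply: ND; [apply: Nx|apply: Ny].
by case: (NP) => -[_ _ NO] _; apply: NO; apply: Nx.
Qed.

Lemma op_span0 : op_span 0. Proof. by have [] := op_span_submodule. Qed.
Lemma op_spanD x y : op_span x -> op_span y -> op_span (x + y).
Proof.
have [_ ND _] := op_span_submodule => Sx Sy.
by rewrite -[x]scale1r; apply: ND.
Qed.
Lemma op_spanZ a x : op_span x -> op_span (a *: x).
Proof.
have [S0 ND _] := op_span_submodule => Sx.
by rewrite -[_ *: _]addr0; apply: ND.
Qed.
Lemma op_spanN x : op_span x -> op_span (- x).
Proof. by rewrite -scaleN1r; apply: op_spanZ. Qed.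
Lemma op_span_op o x : op_span x -> op_span (op o x).
Proof. by have [_ _] := op_span_submodule; apply. Qed.

Definition opquot_equiv : rel M := fun x y => `[< op_span (x - y) >].

Lemma opquot_equivP : equiv_class_of opquot_equiv.
Proof.
split=> [x|x y|y x z]; rewrite /opquot_equiv.
- by apply/asboolP; rewrite subrr; apply: op_span0.
- by apply/asboolP/asboolP => /op_spanN; rewrite opprB.
- move=> /asboolP xy /asboolP yz; apply/asboolP.
  by rewrite -(subrK y x) -addrA; apply: op_spanD.
Qed.

Canonical opquot_equiv_canon := EquivRelPack opquot_equivP.

Definition opquot : Type := {eq_quot opquot_equiv}.
HB.instance Definition _ : EqQuotient M opquot_equiv opquot :=
  EqQuotient.on opquot.
HB.instance Definition _ := Choice.on opquot.

(* locked only keeps unification from unfolding the operations.              *)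
Definition qpi : M -> opquot := locked (fun x : M => \pi_opquot x).

Lemma qpiE x : qpi x = \pi_opquot x.
Proof. by rewrite /qpi -lock. Qed.

Lemma qpiP x y : qpi x = qpi y <-> op_span (x - y).
Proof.
rewrite !qpiE; split=> [/eqP|xy]; first by rewrite piE => /asboolP.
by apply/eqP; rewrite piE; apply/asboolP.
Qed.

Lemma qpi_surj (y : opquot) : exists x, y = qpi x.
Proof. by exists (repr y); rewrite qpiE reprK. Qed.

Lemma qpi_repr (x : M) : op_span (repr (qpi x) - x).
Proof. by apply/qpiP; rewrite qpiE reprK. Qed.

Definition qadd := locked (fun x y : opquot => qpi (repr x + repr y)).
Definition qopp := locked (fun x : opquot => qpi (- repr x)).
Definition qscale := locked (fun a (x : opquot) => qpi (a *: repr x)).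

Lemma qaddE x y : qadd (qpi x) (qpi y) = qpi (x + y).
Proof.
rewrite /qadd -lock; apply/qpiP; rewrite opprD addrACA.
by apply: op_spanD; apply: qpi_repr.
Qed.

Lemma qoppE x : qopp (qpi x) = qpi (- x).
Proof. by rewrite /qopp -lock; apply/qpiP; rewrite -opprD; apply: op_spanN; apply: qpi_repr. Qed.

Lemma qscaleE a x : qscale a (qpi x) = qpi (a *: x).
Proof. by rewrite /qscale -lock; apply/qpiP; rewrite -scalerBr; apply: op_spanZ; apply: qpi_repr. Qed.

Lemma qaddA : associative qadd.
Proof.
move=> x y z; have [x' ->] := qpi_surj x; have [y' ->] := qpi_surj y.
by have [z' ->] := qpi_surj z; rewrite !qaddE addrA.
Qed.
Lemma qaddC : commutative qadd.
Proof. by move=> x y; rewrite /qadd -lock addrC. Qed.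
Lemma qadd0 : left_id (qpi 0) qadd.
Proof. by move=> x; have [x' ->] := qpi_surj x; rewrite qaddE add0r. Qed.
Lemma qaddN : left_inverse (qpi 0) qopp qadd.
Proof.
by move=> x; have [x' ->] := qpi_surj x; rewrite qoppE qaddE addNr.
Qed.
HB.instance Definition _ :=
  GRing.isZmodule.Build opquot qaddA qaddC qadd0 qaddN.

Lemma qscaleA a b x : qscale a (qscale b x) = qscale (a * b) x.
Proof. by have [x' ->] := qpi_surj x; rewrite !qscaleE scalerA. Qed.
Lemma qscale1 : left_id 1 qscale.
Proof. by move=> x; have [x' ->] := qpi_surj x; rewrite !qscaleE scale1r. Qed.
Lemma qscaleDr : right_distributive qscale +%R.
Proof.
move=> a x y; have [x' ->] := qpi_surj x; have [y' ->] := qpi_surj y.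
by rewrite [_ + _]qaddE !qscaleE [RHS]qaddE scalerDr.
Qed.
Lemma qscaleDl x : {morph qscale^~ x : a b / a + b}.
Proof.
by move=> a b; have [x' ->] := qpi_surj x; rewrite !qscaleE [RHS]qaddE scalerDl.
Qed.
HB.instance Definition _ :=
  GRing.Zmodule_isLmodule.Build R opquot qscaleA qscale1 qscaleDr qscaleDl.

Lemma qpi_linear : linear qpi.
Proof.
move=> a x y; rewrite -[_ *: qpi x]/(qscale a (qpi x)) qscaleE.
by rewrite -[RHS]/(qadd _ _) qaddE.
Qed.
HB.instance Definition _ := GRing.isLinear.Build R M opquot *:%R qpi qpi_linear.

Lemma qpi_eq0 x : qpi x = 0 <-> op_span x.
Proof. by rewrite -(linear0 qpi) qpiP subr0. Qed.

Definition qop (o : Om) (x : opquot) : opquot := qpi (op o (repr x)).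

Lemma qopE o x : qop o (qpi x) = qpi (op o x).
Proof. by apply/qpiP; rewrite -linearB; apply: op_span_op; apply: qpi_repr. Qed.

Lemma qop_linear o : linear (qop o).
Proof.
move=> a x y; have [x' ->] := qpi_surj x; have [y' ->] := qpi_surj y.
by rewrite -linearP !qopE !linearP.
Qed.
HB.instance Definition _ o :=
  GRing.isLinear.Build R opquot opquot *:%R (qop o) (qop_linear o).

End Quotient.

Arguments opquot {R M Om} op G.
Arguments qpi {R M Om} op G x.
Arguments qop {R M Om} op G o x.

Definition no_op {R : nzRingType} {M : lmodType R} (o : void) : {linear M -> M} :=
  match o with end.
Definition span {R : nzRingType} {M : lmodType R} : set M -> set M := op_span no_op.

Section MalgLift.
Context {K : choiceType} {R : comNzRingType} {P : lmodType R}.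
Variable f : K -> P.

Definition malg_lift (g : {malg R[K]}) : P := \sum_(k <- msupp g) g@_k *: f k.

Lemma malg_lift_sub (g : {malg R[K]}) (d : {fset K}) :
  (msupp g `<=` d)%fset -> malg_lift g = \sum_(k <- d) g@_k *: f k.
Proof.
move=> le_gd; apply: big_fset_incl => // k _ /mcoeff_outdom ->.
by rewrite scale0r.
Qed.

Lemma malg_lift_linear : linear malg_lift.
Proof.
move=> a x y; set d := (msupp x `|` msupp y)%fset.
have lx : (msupp x `<=` d)%fset by apply: fsubsetUl.
have ly : (msupp y `<=` d)%fset by apply: fsubsetUr.
have lxy : (msupp (a *: x + y) `<=` d)%fset.
  apply: fsubset_trans (msuppD_le _ _) _; rewrite fsubUset ly andbT.
  by apply: fsubset_trans (msuppZ_le _ _) lx.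
rewrite (malg_lift_sub lx) (malg_lift_sub ly) (malg_lift_sub lxy).
rewrite scaler_sumr -big_split /=; apply: eq_bigr => k _.
by rewrite mcoeffD mcoeffZ scalerDl scalerA.
Qed.
HB.instance Definition _ :=
  GRing.isLinear.Build R {malg R[K]} P *:%R malg_lift malg_lift_linear.

Lemma malg_liftU k : malg_lift << k >> = f k.
Proof.
rewrite (malg_lift_sub (msuppU_le)) big_seq_fset1 mcoeffUU scale1r //.
Qed.
End MalgLift.

Section Tensor.
Context {R : comNzRingType}.

Definition bilinear_rel (M N : lmodType R) : set {malg R[(M * N)%type]} :=
  [set t | (exists a x y n, t = << (a *: x + y, n) >> -
                               (a *: << (x, n) >> + << (y, n) >>))
        \/ (exists a m x y, t = << (m, a *: x + y) >> -
                               (a *: << (m, x) >> + << (m, y) >>))].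

Definition tensor (M N : lmodType R) : lmodType R :=
  opquot no_op (@bilinear_rel M N).

Definition tens {M N : lmodType R} (m : M) (n : N) : tensor M N :=
  qpi no_op (@bilinear_rel M N) << (m, n) >>.

Lemma tensPl {M N : lmodType R} a x y (n : N) :
  tens (a *: x + y : M) n = a *: tens x n + tens y n.
Proof.
rewrite /tens -linearP; apply/qpiP; apply: sub_gen_smallest; left.
by exists a, x, y, n.
Qed.

Lemma tensPr {M N : lmodType R} a (m : M) x y :
  tens m (a *: x + y : N) = a *: tens m x + tens m y.
Proof.
rewrite /tens -linearP; apply/qpiP; apply: sub_gen_smallest; right.
by exists a, m, x, y.
Qed.

Section Map.
Context {M N : lmodType R} (f : {linear M -> M}) (g : {linear N -> N}).

Definition tmap_free : {malg R[(M * N)%type]} -> tensor M N :=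
  malg_lift (fun mn => tens (f mn.1) (g mn.2)).
HB.instance Definition _ := GRing.Linear.on tmap_free.

Lemma tmap_freeU mn : tmap_free << mn >> = tens (f mn.1) (g mn.2).
Proof. exact: malg_liftU. Qed.

Lemma tmap_free0 t : span (@bilinear_rel M N) t -> tmap_free t = 0.
Proof.
apply: (smallest_sub (X := [set t | tmap_free t = 0])) => [|u].
  split=> [|a x y /= x0 y0|[] //]; first exact: linear0.
  by rewrite linearP /= x0 y0 scaler0 addr0.
case=> [[a [x [y [n ->]]]]|[a [m [x [y ->]]]]] /=.
  by rewrite linearB linearP /= !tmap_freeU /= linearP tensPl subrr.
by rewrite linearB linearP /= !tmap_freeU /= linearP tensPr subrr.
Qed.

Definition tmap (t : tensor M N) : tensor M N := tmap_free (repr t).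

Lemma tmap_pi t : tmap (qpi _ _ t) = tmap_free t.
Proof.
apply/eqP; rewrite -subr_eq0 /tmap -linearB; apply/eqP.
by apply: tmap_free0; apply: qpi_repr.
Qed.

Lemma tmap_linear : linear tmap.
Proof.
move=> a x y; have [x' ->] := qpi_surj x; have [y' ->] := qpi_surj y.
by rewrite -linearP !tmap_pi linearP.
Qed.
HB.instance Definition _ :=
  GRing.isLinear.Build R (tensor M N) (tensor M N) *:%R tmap tmap_linear.

Lemma tmapE m n : tmap (tens m n) = tens (f m) (g n).
Proof. by rewrite tmap_pi tmap_freeU. Qed.
End Map.
End Tensor.

(* V[[hbar]], by coefficients, with the Cauchy product as k[[hbar]]-action.  *)
Definition pseries (V : Type) : Type := nat -> V.
HB.instance Definition _ V := gen_eqMixin (pseries V).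
HB.instance Definition _ V := gen_choiceMixin (pseries V).

Section PseriesZmod.
Context {V : zmodType}.
Implicit Types f g : pseries V.
Definition ps_zero : pseries V := fun=> 0.
Definition ps_opp f : pseries V := fun n => - f n.
Definition ps_add f g : pseries V := fun n => f n + g n.
Fact ps_addA : associative ps_add.
Proof. by move=> f g h; apply/funext => n; rewrite /ps_add addrA. Qed.
Fact ps_addC : commutative ps_add.
Proof. by move=> f g; apply/funext => n; rewrite /ps_add addrC. Qed.
Fact ps_add0 : left_id ps_zero ps_add.
Proof. by move=> f; apply/funext => n; rewrite /ps_add add0r. Qed.
Fact ps_addN : left_inverse ps_zero ps_opp ps_add.
Proof. by move=> f; apply/funext => n; rewrite /ps_add addNr. Qed.
HB.instance Definition _ :=
  GRing.isZmodule.Build (pseries V) ps_addA ps_addC ps_add0 ps_addN.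
End PseriesZmod.

Section Cauchy.
Context {k : comNzRingType}.

Definition cauchy {V : lmodType k} (f : pseries k) (v : pseries V) : pseries V :=
  fun n => \sum_(i < n.+1) f i *: v (n - i)%N.

Lemma cauchyA (V : lmodType k) (f g : pseries k) (v : pseries V) :
  cauchy f (cauchy g v) = cauchy (cauchy f (g : pseries k^o)) v.
Proof.
apply/funext => n; rewrite /cauchy.
pose F j i := (f j * g (n - j - i)%N) *: v i.
transitivity (\sum_(j < n.+1) \sum_(i < n.+1 | (i <= n - j)%N) F j i).
  apply: eq_bigr => j _; rewrite (big_ord_narrow_leq (leq_subr _ _)) /=.
  rewrite scaler_sumr (reindex_inj rev_ord_inj) /=.
  apply: eq_bigr => i _; rewrite scalerA subSS subKn //.
  by rewrite -ltnS ltn_ord.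
transitivity (\sum_(i < n.+1) \sum_(j < n.+1 | (j <= n - i)%N) F j i).
  rewrite (exchange_big_dep predT) //=; apply: eq_bigr => i _.
  apply: eq_bigl => j; have := ltn_ord i; have := ltn_ord j; rewrite !ltnS => jn le_in.
  by rewrite !leq_subRL // addnC.
rewrite [RHS](reindex_inj rev_ord_inj) /=; apply: eq_bigr => i _.
rewrite (big_ord_narrow_leq (leq_subr _ _)) /= subSS scaler_suml subKn -1?ltnS //.
by apply: eq_bigr => j _; rewrite /F subnAC.
Qed.

Lemma cauchyDr (V : lmodType k) (f : pseries k) :
  {morph @cauchy V f : v w / v + w}.
Proof.
move=> v w; apply/funext => n; rewrite [RHS]/GRing.add /= /ps_add /cauchy.
by rewrite -big_split /=; apply: eq_bigr => i _; rewrite -scalerDr.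
Qed.

Lemma cauchyDl (V : lmodType k) (v : pseries V) :
  {morph (fun f : pseries k => cauchy f v) : f g / f + g}.
Proof.
move=> f g; apply/funext => n; rewrite [RHS]/GRing.add /= /ps_add /cauchy.
by rewrite -big_split /=; apply: eq_bigr => i _; rewrite -scalerDl.
Qed.

Definition ps_const (a : k) : pseries k := fun n => if n is 0%N then a else 0.

Lemma cauchy_const (V : lmodType k) a (v : pseries V) :
  cauchy (ps_const a) v = (fun n => a *: v n).
Proof.
apply/funext => n; rewrite /cauchy big_ord_recl big1 ?addr0 ?subn0 //.
by move=> i _; rewrite scale0r.
Qed.

Lemma cauchy1 (V : lmodType k) : left_id (ps_const 1) (@cauchy V).
Proof.
by move=> v; rewrite cauchy_const; apply/funext => n; rewrite scale1r.
Qed.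

Definition ps_mul (f g : pseries k) : pseries k := @cauchy k^o f g.

Fact ps_mulC : commutative ps_mul.
Proof.
move=> f g; apply/funext => n; rewrite /ps_mul /cauchy.
rewrite (reindex_inj rev_ord_inj) /=; apply: eq_bigr => i _.
by rewrite subSS subKn -1?ltnS // [LHS]mulrC.
Qed.
Fact ps_mulA : associative ps_mul.
Proof. by move=> f g h; rewrite /ps_mul cauchyA. Qed.
Fact ps_mul1 : left_id (ps_const 1) ps_mul.
Proof. exact: (@cauchy1 k^o). Qed.
Fact ps_mulDl : left_distributive ps_mul +%R.
Proof. by move=> f g h; apply: (@cauchyDl k^o). Qed.
Fact ps_oneN0 : ps_const 1 != 0.
Proof. by apply/eqP => /(congr1 (@^~ 0%N)) /eqP; rewrite oner_eq0. Qed.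
HB.instance Definition _ := GRing.Zmodule_isComNzRing.Build (pseries k)
  ps_mulA ps_mulC ps_mul1 ps_mulDl ps_oneN0.

(* The inverse of a series which has one; other series are left unchanged.   *)
Definition ps_unit : pred (pseries k) := fun f => `[< exists g, g * f = 1 >].
Definition ps_inv (f : pseries k) : pseries k :=
  if pselect (exists g, g * f = 1) is left e then projT1 (cid e) else f.
Fact ps_mulV : {in ps_unit, left_inverse 1 ps_inv *%R}.
Proof.
by move=> f /asboolP uf; rewrite /ps_inv; case: pselect => // e; case: cid.
Qed.
Fact ps_unitP f g : g * f = 1 -> ps_unit f.
Proof. by move=> gf; apply/asboolP; exists g. Qed.
Fact ps_invN : {in [predC ps_unit], ps_inv =1 id}.
Proof.
move=> f /negP nf; rewrite /ps_inv; case: pselect => // e.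
by case: nf; apply/asboolP.
Qed.
HB.instance Definition _ := GRing.ComNzRing_hasMulInverse.Build (pseries k)
  ps_mulV ps_unitP ps_invN.

Section PseriesLmod.
Context {V : lmodType k}.
Fact ps_scaleA (f g : pseries k) (v : pseries V) :
  cauchy f (cauchy g v) = cauchy (f * g) v.
Proof. exact: cauchyA. Qed.
HB.instance Definition _ := GRing.Zmodule_isLmodule.Build (pseries k) (pseries V)
  ps_scaleA (@cauchy1 V) (@cauchyDr V) (@cauchyDl V).
End PseriesLmod.

Definition hbar : pseries k := fun n => (n == 1%N)%:R.

End Cauchy.

Definition exp_hbar {k : fieldType} : pseries k := fun n => (n`!%:R)^-1.

Section AlgQuotient.
Context {R : comNzRingType} {B : algType R}.
Variable G : set B.

Definition alg_mul (o : B + B) (x : B) : B :=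
  match o with inl a => a * x | inr b => x * b end.

Lemma alg_mul_linear o : linear (alg_mul o).
Proof.
case: o => a k x y /=; first by rewrite mulrDr scalerAr.
by rewrite mulrDl scalerAl.
Qed.
HB.instance Definition _ o :=
  GRing.isLinear.Build R B B *:%R (alg_mul o) (alg_mul_linear o).

(* op_span alg_mul G is the two-sided ideal generated by G.                   *)
Definition algquot : Type := opquot alg_mul G.
HB.instance Definition _ := GRing.Lmodule.on algquot.

Definition aqpi : B -> algquot := qpi alg_mul G.
HB.instance Definition _ := GRing.Linear.on aqpi.

Lemma aqpi_surj (x : algquot) : exists x', x = aqpi x'.
Proof. exact: qpi_surj. Qed.

Definition aqmul := locked (fun x y : algquot => aqpi (repr x * repr y)).

Lemma aqmulE x y : aqmul (aqpi x) (aqpi y) = aqpi (x * y).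
Proof.
rewrite /aqmul -lock; apply/qpiP; set x' := repr _; set y' := repr _.
have -> : x' * y' - x * y = alg_mul (inr y') (x' - x) + alg_mul (inl x) (y' - y).
  by rewrite /= mulrBl mulrBr addrA subrK.
by apply: op_spanD; apply: op_span_op; apply: qpi_repr.
Qed.

Fact aqmulA : associative aqmul.
Proof.
move=> x y z; have [x' ->] := aqpi_surj x; have [y' ->] := aqpi_surj y.
by have [z' ->] := aqpi_surj z; rewrite !aqmulE mulrA.
Qed.
Fact aqmul1l : left_id (aqpi 1) aqmul.
Proof. by move=> x; have [x' ->] := aqpi_surj x; rewrite aqmulE mul1r. Qed.
Fact aqmul1r : right_id (aqpi 1) aqmul.
Proof. by move=> x; have [x' ->] := aqpi_surj x; rewrite aqmulE mulr1. Qed.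
Fact aqmulDl : left_distributive aqmul +%R.
Proof.
move=> x y z; have [x' ->] := aqpi_surj x; have [y' ->] := aqpi_surj y.
by have [z' ->] := aqpi_surj z; rewrite -linearD !aqmulE -linearD mulrDl.
Qed.
Fact aqmulDr : right_distributive aqmul +%R.
Proof.
move=> x y z; have [x' ->] := aqpi_surj x; have [y' ->] := aqpi_surj y.
by have [z' ->] := aqpi_surj z; rewrite -linearD !aqmulE -linearD mulrDr.
Qed.
(* The quotient may be zero, hence only a pzRingType.                        *)
HB.instance Definition _ := GRing.Zmodule_isPzRing.Build algquot
  aqmulA aqmul1l aqmul1r aqmulDl aqmulDr.

Lemma aqpiM x y : aqpi (x * y) = aqpi x * aqpi y.
Proof. by rewrite -aqmulE. Qed.

Lemma aqpi1 : aqpi 1 = 1. Proof. by []. Qed.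

Lemma aq_scalerAl a (x y : algquot) : a *: (x * y) = (a *: x) * y.
Proof.
have [x' ->] := aqpi_surj x; have [y' ->] := aqpi_surj y.
by rewrite -aqpiM -!linearZ /= -aqpiM scalerAl.
Qed.

Lemma aq_scalerAr a (x y : algquot) : a *: (x * y) = x * (a *: y).
Proof.
have [x' ->] := aqpi_surj x; have [y' ->] := aqpi_surj y.
by rewrite -aqpiM -!linearZ /= -aqpiM scalerAr.
Qed.

Definition aq_lmul (a x : algquot) : algquot := a * x.
Lemma aq_lmul_linear a : linear (aq_lmul a).
Proof. by move=> k x y; rewrite /aq_lmul mulrDr aq_scalerAr. Qed.
HB.instance Definition _ a :=
  GRing.isLinear.Build R algquot algquot *:%R (aq_lmul a) (aq_lmul_linear a).

Definition aq_rmul {n} (b : algquot) (m : {ffun 'I_n -> algquot}) :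
  {ffun 'I_n -> algquot} := [ffun j => m j * b].
Lemma aq_rmul_linear n b : linear (@aq_rmul n b).
Proof. by move=> k x y; apply/ffunP => j; rewrite !ffunE mulrDl aq_scalerAl. Qed.
HB.instance Definition _ n b :=
  GRing.isLinear.Build R {ffun 'I_n -> algquot} {ffun 'I_n -> algquot} *:%R
    (@aq_rmul n b) (@aq_rmul_linear n b).
End AlgQuotient.

Arguments algquot {R B} G.
Arguments aqpi {R B} G x.

(* A matrix t : 'M_3 stands for the tensor \sum_(i, j) t i j * x_i (x) x_j,   *)
(* where (x_0, x_1, x_2) = (u, v, w); the same encoding serves for V (x) V'   *)
(* and V' (x) V.                                                             *)
Section Spin.
Context {R : comUnitRingType}.
Variable q : R.

Local Notation uu := (delta_mx 0 0 : 'M[R]_3).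
Local Notation uv := (delta_mx 0 1 : 'M[R]_3).
Local Notation uw := (delta_mx 0 2%:R : 'M[R]_3).
Local Notation vu := (delta_mx 1 0 : 'M[R]_3).
Local Notation vv := (delta_mx 1 1 : 'M[R]_3).
Local Notation vw := (delta_mx 1 2%:R : 'M[R]_3).
Local Notation wu := (delta_mx 2%:R 0 : 'M[R]_3).
Local Notation wv := (delta_mx 2%:R 1 : 'M[R]_3).
Local Notation ww := (delta_mx 2%:R 2%:R : 'M[R]_3).

Definition v0 : 'M[R]_3 := (q ^+ 3 + q) *: uw + vv + (q + q^-1) *: wu.

Definition spin (i : 'I_3) : set 'M[R]_3 :=
  match val i with
  | 0%N => span [set v0]
  | 1%N => span [set q ^+ 2 *: uv - vu;
                   (q ^+ 3 + q) *: (uw - wu) + (1 - q ^+ 2) *: vv;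
                   wv - q ^+ 2 *: vw]
  | _ => span [set uu;
                   uv + q ^+ 2 *: vu;
                   uw - q *: vv + q ^+ 4 *: wu;
                   vw + q ^+ 2 *: wv;
                   ww]
  end.

Definition spin_projectors (P : 'I_3 -> {linear 'M[R]_3 -> 'M[R]_3}) : Prop :=
  forall i j t, spin j t -> P i t = if i == j then t else 0.

(* The covariant operators are those of the form x P_0 + y P_1 + z P_2, the   *)
(* V_i being irreducible and pairwise non-isomorphic.                        *)
Definition transposition (S : {linear 'M[R]_3 -> 'M[R]_3}) : Prop :=
  bijective S /\
  exists P x y z, spin_projectors P /\
    forall t, S t = x *: P 0 t + y *: P 1 t + z *: P 2%:R t.
End Spin.

Lemma malg_scalerAr {K : monomType} {R : comNzRingType} (a : R)
  (x y : {malg R[K]}) : a *: (x * y) = x * (a *: y).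
Proof.
have E (z : {malg R[K]}) : a%:MP * z = a *: z by exact: mul_malgC.
have C : x * a%:MP = a%:MP * x.
  rewrite [LHS]fgmulgU [RHS]fgmulUg; apply: eq_bigr => l _.
  by rewrite mulrC mul1m mulm1.
by rewrite -!E mulrA -C mulrA.
Qed.

Section FreeAlgebra.
Context {R : comNzRingType}.

(* T(V), free on the letters u, v, w.                                        *)
Definition freeV : Type := {malg R[{fmonom 'I_3}]}.
HB.instance Definition _ := GRing.Lalgebra.on freeV.

Fact freeV_scalerAr (a : R) (x y : freeV) : a *: (x * y) = x * (a *: y).
Proof. exact: malg_scalerAr. Qed.
HB.instance Definition _ := GRing.Lalgebra_isAlgebra.Build R freeV freeV_scalerAr.

Definition letter (i : 'I_3) : freeV := << fmu i >> : {malg R[{fmonom 'I_3}]}.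

Definition quadratic (t : 'M[R]_3) : freeV :=
  \sum_i \sum_j t i j *: (letter i * letter j).
End FreeAlgebra.
Arguments freeV R : clear implicits.

Section Sphere.
Context {R : comUnitRingType}.
Variables (q c : R).

Definition sphere_rel : set (freeV R) :=
  [set quadratic t | t in spin q 1] `|` [set quadratic (v0 q) - c%:A].

Definition sphere : Type := algquot sphere_rel.
HB.instance Definition _ := GRing.Lmodule.on sphere.
HB.instance Definition _ := GRing.PzRing.on sphere.

Definition gen (i : 'I_3) : sphere := aqpi sphere_rel (letter i).

(* m : VA stands for \sum_j dx_j (x) m j in V' (x) A; the same type also      *)
(* encodes A (x) V', where it stands for \sum_j m j (x) dx_j.                 *)
Definition VA : lmodType R := {ffun 'I_3 -> sphere}.

(* dx_j (x) a                                                                *)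
Definition dtens (j : 'I_3) (a : sphere) : VA := [ffun l => if l == j then a else 0].

(* mu^23 (t (x) a) in V' (x) A, for t in V' (x) V                            *)
Definition mu23 (t : 'M[R]_3) (a : sphere) : VA :=
  [ffun i => (\sum_j t i j *: gen j) * a].

(* mu^12 (a (x) t) in A (x) V', for t in V (x) V'                            *)
Definition mu12 (a : sphere) (t : 'M[R]_3) : VA :=
  [ffun j => a * (\sum_i t i j *: gen i)].

Definition Mr : set VA := span [set mu23 t a | t in spin q 0 & a in setT].
Definition Ml : set VA := span [set mu12 a t | a in setT & t in spin q 0].

Definition VA_mul (b : sphere) : {linear VA -> VA} := aq_rmul b.
Definition cotangent_r : lmodType R := opquot VA_mul Mr.
Definition cot_r_pi : {linear VA -> cotangent_r} := qpi VA_mul Mr.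
Definition cot_r_mul (b : sphere) : {linear cotangent_r -> cotangent_r} :=
  qop VA_mul Mr b.

Definition AVA : lmodType R := tensor (sphere : lmodType R) VA.

(* The bimodule structure of A (x) V' (x) A: inl a is left multiplication by  *)
(* a, inr b is right multiplication by b.                                    *)
Definition AVA_mul (o : sphere + sphere) : {linear AVA -> AVA} :=
  match o with
  | inl a => tmap (aq_lmul a) idfun
  | inr b => tmap idfun (VA_mul b)
  end.

(* a (x) m in A (x) V' (x) A, for m in V' (x) A                               *)
Definition A_tens (a : sphere) (m : VA) : AVA := tens (a : (sphere : lmodType R)) m.

(* m (x) b in A (x) V' (x) A, for m in A (x) V'                              *)
Definition AV_tens (m : VA) (b : sphere) : AVA :=
  \sum_j A_tens (m j) (dtens j b).

Definition bar_rel : set AVA :=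
  [set AV_tens m b | m in Ml & b in setT] `|`
  [set A_tens a m | a in setT & m in Mr].

(* \overline{T^*}; bar_rel spans the sub-bimodule M_l (x) A + A (x) M_r.      *)
Definition cotangent_bar : lmodType R := opquot AVA_mul bar_rel.
Definition cot_bar_pi : AVA -> cotangent_bar := qpi AVA_mul bar_rel.
Definition cot_bar_mul (o : sphere + sphere) : {linear cotangent_bar -> cotangent_bar} :=
  qop AVA_mul bar_rel o.

Section Transposition.
Variable S : {linear 'M[R]_3 -> 'M[R]_3}.

(* t (x) 1 - 1 (x) S t, for t in V (x) V'                                    *)
Definition permutation_rel : set cotangent_bar :=
  [set cot_bar_pi (AV_tens (mu12 1 t) 1 - A_tens 1 (mu23 (S t) 1))
  | t in setT].

Definition cotangent : lmodType R := opquot cot_bar_mul permutation_rel.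
Definition cot_pi (t : AVA) : cotangent :=
  qpi cot_bar_mul permutation_rel (cot_bar_pi t).
Definition cot_mul (o : sphere + sphere) : {linear cotangent -> cotangent} :=
  qop cot_bar_mul permutation_rel o.

(* The actions of u, v, w on both sides. They determine the bimodule         *)
(* structure and, unlike A itself, are indexed independently of q and of the *)
(* base ring, so that bimodules over different A can be compared.            *)
Definition cot_letter_mul (o : 'I_3 + 'I_3) : {linear cotangent -> cotangent} :=
  cot_mul match o with inl i => inl (gen i) | inr i => inr (gen i) end.
End Transposition.
End Sphere.

Section Completion.
Context {k : comNzRingType} {M : lmodType (pseries k)} {Om : Type}.
Variable op : Om -> {linear M -> M}.

Definition hquot (n : nat) : lmodType (pseries k) :=
  opquot op [set hbar ^+ n *: m | m in setT].
Definition hpi n : {linear M -> hquot n} := qpi op [set hbar ^+ n *: m | m in setT].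

(* The hbar-adic completion of M, i.e. the inverse limit of the M / hbar^n M. *)
Record completion : Type := Completion {
  comp_seq : forall n, hquot n;
  comp_coherent : forall n, exists m, comp_seq n = hpi n m
                                   /\ comp_seq n.+1 = hpi n.+1 m }.

Lemma completionP (x y : completion) : (forall n, comp_seq x n = comp_seq y n) -> x = y.
Proof.
case: x y => [x xP] [y yP] /= exy.
have {exy} exy : x = y by apply/functional_extensionality_dep.
by case: y / exy yP => yP; rewrite (Prop_irrelevance xP yP).
Qed.

HB.instance Definition _ := gen_eqMixin completion.
HB.instance Definition _ := gen_choiceMixin completion.

Program Definition comp_zero : completion := @Completion (fun n => 0) _.
Next Obligation. by exists 0; rewrite !linear0. Qed.
Program Definition comp_opp (x : completion) : completion :=
  @Completion (fun n => - comp_seq x n) _.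
Next Obligation.
by have [m [-> ->]] := comp_coherent x n; exists (- m); rewrite !linearN.
Qed.
Program Definition comp_add (x y : completion) : completion :=
  @Completion (fun n => comp_seq x n + comp_seq y n) _.
Next Obligation.
have [m [-> ->]] := comp_coherent x n; have [p [-> ->]] := comp_coherent y n.
by exists (m + p); rewrite !linearD.
Qed.
Program Definition comp_scale (a : pseries k) (x : completion) : completion :=
  @Completion (fun n => a *: comp_seq x n) _.
Next Obligation.
by have [m [-> ->]] := comp_coherent x n; exists (a *: m); rewrite !linearZ.
Qed.
Program Definition comp_op (o : Om) (x : completion) : completion :=
  @Completion (fun n => qop op _ o (comp_seq x n)) _.
Next Obligation.
have [m [-> ->]] := comp_coherent x n; exists (op o m).
by split; apply: qopE.
Qed.

Fact comp_addA : associative comp_add.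
Proof. by move=> x y z; apply: completionP => n /=; rewrite addrA. Qed.
Fact comp_addC : commutative comp_add.
Proof. by move=> x y; apply: completionP => n /=; rewrite addrC. Qed.
Fact comp_add0 : left_id comp_zero comp_add.
Proof. by move=> x; apply: completionP => n /=; rewrite add0r. Qed.
Fact comp_addN : left_inverse comp_zero comp_opp comp_add.
Proof. by move=> x; apply: completionP => n /=; rewrite addNr. Qed.
HB.instance Definition _ :=
  GRing.isZmodule.Build completion comp_addA comp_addC comp_add0 comp_addN.

Fact comp_scaleA a b x : comp_scale a (comp_scale b x) = comp_scale (a * b) x.
Proof. by apply: completionP => n /=; rewrite scalerA. Qed.
Fact comp_scale1 : left_id 1 comp_scale.
Proof. by move=> x; apply: completionP => n /=; rewrite scale1r. Qed.
Fact comp_scaleDr : right_distributive comp_scale +%R.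
Proof. by move=> a x y; apply: completionP => n /=; rewrite scalerDr. Qed.
Fact comp_scaleDl x : {morph comp_scale^~ x : a b / a + b}.
Proof. by move=> a b; apply: completionP => n /=; rewrite scalerDl. Qed.
HB.instance Definition _ := GRing.Zmodule_isLmodule.Build (pseries k) completion
  comp_scaleA comp_scale1 comp_scaleDr comp_scaleDl.
End Completion.

Arguments completion {k M Om} op.
Arguments comp_op {k M Om} op o x.

(* Vh, with operators oph, is a flat deformation of V, with operators op:      *)
(* Vh / hbar Vh is isomorphic to V as a k-module with operators (rho is the   *)
(* resulting surjection, with kernel hbar Vh), and Vh is isomorphic to        *)
(* V[[hbar]] as a k[[hbar]]-module.                                          *)
Definition flat_deformation {k : comNzRingType} {Om : Type}
    (V : lmodType k) (op : Om -> V -> V)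
    (Vh : lmodType (pseries k)) (oph : Om -> Vh -> Vh) : Prop :=
  (exists rho : Vh -> V,
     [/\ forall (a : k) x y, rho (ps_const a *: x + y) = a *: rho x + rho y,
         forall y, exists x, rho x = y,
         forall x, rho x = 0 <-> exists x', x = hbar *: x'
       & forall o x, rho (oph o x) = op o (rho x)])
  /\ (exists phi : {linear Vh -> pseries V}, bijective phi).

Definition ground_field (R : realType) (cplx : bool) : numFieldType :=
  if cplx then (R[i] : numFieldType) else (R : numFieldType).

(* x_i (x) dx_j |-> dx_j (x) x_i; the classical cotangent bimodule is         *)
(* cotangent 1 c flip.                                                       *)
Definition flip {k : comNzRingType} : {linear 'M[k]_3 -> 'M[k]_3} := @trmx k 3 3.

(* Main.v *)
Require Import Defs.
From HB Require Import structures.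
From mathcomp Require Import all_boot all_algebra.
From mathcomp Require Import boolp classical_sets cardinality reals complex.
From mathcomp Require Import finmap ring.
From mathcomp.multinomials Require Import monalg.
Import GRing.Theory Num.Theory.
Local Open Scope classical_set_scope.
Local Open Scope ring_scope.
Set Implicit Arguments.
Unset Strict Implicit.

(** A transposition acts on the spin 0, 1, 2 components
by scalars x, y, z, and z is nonzero because S is injective.  The permutation
rule lets every element of the cotangent bimodule be written as the class of
some 1 (x) m with m in V' (x) A (one_tens_surj), and left multiplication by a
letter becomes an explicit operator on V' (x) A (left_act).  Two relations that
hold in the bimodule need not be consequences of M_r.

- Multiplying the relation v_0 = 0 in V' (x) A by u on the left gives again an
  element that vanishes; modulo M_r and the relations of A it is a multiple of
  du, with coefficient proportional to q^2 y + (1 - q^2 + q^4) z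
  (obstruction_du).  For generic q the vectors of spin 1 and even degree at
  most 2 in V' (x) A are, modulo M_r, combinations of du, dv, dw, which is why
  nothing but du can survive.
- The relation q^2 uv - vu = 0 of A, applied on the left to du, is a vector of
  highest weight in V_1 (x) V', hence yields a multiple of the vector
  q^4 du uv - dv uu, with coefficient (q^4 y + z)(y + q^4 z)
  (obstruction_V2).

If both coefficients vanish then so does the square of z (q^2 - 1)(q^4 + 1),
which is impossible unless q is 0 or a root of unity (spin2_coef).  So one of
the two vectors dies in the cotangent bimodule.

Neither vector lies in M_r.  The sphere has the character u = 1, v = 0, w = mu
with mu (q + q^-1)(q^2 + 1) = c (sphere_character); the fibre of the right
cotangent module there is the quotient of k^3 by the single vector coming from
v_0, a plane, and both vectors have nonzero image in it (cotangent_fibre).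
Hence the canonical map is not injective.

Over k[[hbar]] a flat deformation would be free of torsion, so one of the two
vectors would vanish in the completed bimodule although its coefficient is only
a nonzero power series.  At q = 1 with the flip the classical bimodule maps
onto the same plane k^2, with letters acting on both sides through the
character (classical_fibre).  Pulled back along the reduction modulo hbar this
gives a surjection onto k^2 which is determined by the images of du, dv, dw
(flat_fibre).  These satisfy the relation coming from v_0 and the one coming
from the vector that vanished, so they span at most a line: a contradiction. *)

(** * Quotients and tensor products *)

Section QuotientLift.
Context {R : nzRingType} {M : lmodType R} {Om : Type}.
Variables (op : Om -> {linear M -> M}) (G : set M).

Lemma op_span_ind (N : set M) :
  op_submodule op N -> G `<=` N -> op_span op G `<=` N.
Proof. exact: smallest_sub. Qed.

Lemma op_span_gen x : G x -> op_span op G x.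
Proof. exact: sub_gen_smallest. Qed.

Lemma qpi_gen x : G x -> qpi op G x = 0.
Proof. by move=> Gx; apply/qpi_eq0; apply: op_span_gen. Qed.

Lemma op_span_lker (P : lmodType R) (f : {linear M -> P}) :
  (forall x, G x -> f x = 0) ->
  (forall o x, f x = 0 -> f (op o x) = 0) ->
  forall x, op_span op G x -> f x = 0.
Proof.
move=> fG fop; apply: (op_span_ind (N := [set x | f x = 0])) => //.
split=> [|a x y /= fx fy|o x]; [exact: linear0| |exact: fop].
by rewrite linearP fx fy scaler0 addr0.
Qed.

Lemma opquot_lift (P : lmodType R) (f : {linear M -> P}) :
  (forall x, op_span op G x -> f x = 0) ->
  exists g : {linear opquot op G -> P}, forall x, g (qpi op G x) = f x.
Proof.
move=> f0; pose g (x : opquot op G) := f (repr x).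
have gE x : g (qpi op G x) = f x.
  by apply/eqP; rewrite -subr_eq0 /g -linearB; apply/eqP; apply: f0; exact: qpi_repr.
have gl : linear g.
  move=> a x y; have [x' ->] := qpi_surj x; have [y' ->] := qpi_surj y.
  by rewrite -linearP !gE linearP.
pose gL : {linear opquot op G -> P} := HB.pack g (GRing.isLinear.Build _ _ _ _ g gl).
by exists gL.
Qed.
End QuotientLift.

Section TensorLift.
Context {R : comNzRingType} {M N : lmodType R}.

Lemma tensor_ind (X : set (tensor M N)) :
  op_submodule no_op X -> (forall m n, X (tens m n)) -> forall t, X t.
Proof.
move=> [X0 XD _] Xt t; have [g ->] := qpi_surj t.
rewrite [g]monalgE linear_sum /=.
apply: (big_ind X) => // [x y Xx Xy|[m n] _]; first by rewrite -[x]scale1r; apply: XD.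
have -> : << g@_(m, n) *g (m, n) >> = g@_(m, n) *: << (m, n) >> :> {malg R[(M * N)%type]}.
  by apply/malgP => k; rewrite mcoeffZ !mcoeffU mulr_natr.
by rewrite linearZ /= -[_ *: _]addr0; apply: XD => //; apply: Xt.
Qed.

Lemma tensor_lift (P : lmodType R) (f : M -> N -> P) :
  (forall n, linear (f^~ n)) -> (forall m, linear (f m)) ->
  exists g : {linear tensor M N -> P}, forall m n, g (tens m n) = f m n.
Proof.
move=> fl fr; pose h : {linear {malg R[(M * N)%type]} -> P} :=
  malg_lift (fun mn => f mn.1 mn.2).
have hU mn : h << mn >> = f mn.1 mn.2 by exact: malg_liftU.
have [|g gE] := @opquot_lift _ _ _ no_op (@bilinear_rel _ M N) P h.
  apply: op_span_lker => [t|[] //].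
  case=> [[a [x [y [n ->]]]]|[a [m [x [y ->]]]]]; rewrite linearB linearP /= !hU /=.
    by rewrite fl subrr.
  by rewrite fr subrr.
by exists g => m n; rewrite /tens gE hU.
Qed.
End TensorLift.

(** * The quantum sphere *)

Lemma big_ord3 (V : nmodType) (F : 'I_3 -> V) : \sum_i F i = F 0 + F 1 + F 2%:R.
Proof.
rewrite 3!big_ord_recl big_ord0 addr0 addrA.
by congr (F _ + F _ + F _); apply/val_inj.
Qed.

Lemma ord3P (X : 'I_3 -> Prop) : X 0 -> X 1 -> X 2%:R -> forall i, X i.
Proof.
move=> X0 X1 X2 [[|[|[|//]]] lt_i].
- by have -> : Ordinal lt_i = 0 by apply/val_inj.
- by have -> : Ordinal lt_i = 1 by apply/val_inj.
- by have -> : Ordinal lt_i = 2%:R by apply/val_inj.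
Qed.

Lemma sum_delta_mx {R : comNzRingType} {V : lmodType R} (F : 'I_3 -> V) (i0 j0 l : 'I_3) :
  \sum_i (delta_mx i0 j0 : 'M[R]_3) i l *: F i = if l == j0 then F i0 else 0.
Proof.
rewrite (bigD1 i0) //= mxE eqxx /= big1 ?addr0 => [|i ii0].
  by case: eqP => _; rewrite ?scale1r ?scale0r.
by rewrite mxE (negbTE ii0) scale0r.
Qed.

Section MxEval.
Context {R : comNzRingType} {V : lmodType R}.
Variable F : 'I_3 -> 'I_3 -> V.

(** The linear map on V (x) V sending x_i (x) x_j to F i j.  Identities between
   combinations of vectors F i j are proved by comparing matrices entrywise. *)
Definition mx_eval (t : 'M[R]_3) : V := \sum_i \sum_j t i j *: F i j.

Lemma mx_eval_linear : linear mx_eval.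
Proof.
move=> a x y; rewrite /mx_eval scaler_sumr -big_split; apply: eq_bigr => i _.
rewrite scaler_sumr -big_split; apply: eq_bigr => j _ /=.
by rewrite !mxE scalerDl scalerA.
Qed.
HB.instance Definition _ := GRing.isLinear.Build R 'M[R]_3 V *:%R mx_eval mx_eval_linear.

Lemma mx_evalD x y : mx_eval (x + y) = mx_eval x + mx_eval y.
Proof. exact: linearD. Qed.
Lemma mx_evalN x : mx_eval (- x) = - mx_eval x.
Proof. exact: linearN. Qed.
Lemma mx_evalZ a x : mx_eval (a *: x) = a *: mx_eval x.
Proof. exact: linearZ. Qed.

Lemma mx_eval_delta i j : mx_eval (delta_mx i j) = F i j.
Proof.
rewrite /mx_eval (bigD1 i) //= (bigD1 j) //= big1 => [|l lj].
  rewrite mxE !eqxx scale1r addr0 big1 ?addr0 // => l li.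
  by rewrite big1 // => m _; rewrite mxE (negbTE li) scale0r.
by rewrite mxE (negbTE lj) andbF scale0r.
Qed.
End MxEval.

Lemma mx_eval_comp {R : comNzRingType} {V W : lmodType R} (f : {linear V -> W})
  (F : 'I_3 -> 'I_3 -> V) t : f (mx_eval F t) = mx_eval (fun i j => f (F i j)) t.
Proof.
rewrite linear_sum; apply: eq_bigr => i _; rewrite linear_sum.
by apply: eq_bigr => j _; rewrite linearZ.
Qed.

Section FreeAlgebra.
Context {R : comNzRingType}.

Lemma freeV_ind (X : set (freeV R)) :
  (forall a x y, X x -> X y -> X (a *: x + y)) ->
  (forall s : seq 'I_3, X (\prod_(i <- s) letter i)) -> forall x, X x.
Proof.
move=> XD Xw x; have X0 : X 0.
  rewrite -(subrr (1 : freeV R)) addrC -scaleN1r.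
  by apply: XD; have := Xw [::]; rewrite big_nil.
have wE (s : seq 'I_3) : \prod_(i <- s) letter i = << FMonom s >> :> freeV R.
  elim: s => [|i s IH]; first by rewrite big_nil -fmoneE.
  rewrite big_cons IH.
  transitivity (<< fmmul (fmu i) (FMonom s) >> : {malg R[{fmonom 'I_3}]}).
    by rewrite [LHS]fgmulUU mulr1.
  by rewrite fmmulE fmuE.
rewrite [x]monalgE; apply: (big_ind X) => // [y z Xy Xz|[s] _].
  by rewrite -[y]scale1r; apply: XD.
have -> : << x@_(FMonom s) *g FMonom s >> = x@_(FMonom s) *: << FMonom s >>
    :> {malg R[{fmonom 'I_3}]}.
  by apply/malgP => k; rewrite mcoeffZ !mcoeffU mulr_natr.
by rewrite -[_ *: _]addr0; apply: XD => //; have := Xw s; rewrite wE.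
Qed.

(** The universal property of T(V), for values in a commutative ring. *)
Lemma freeV_eval (X : 'I_3 -> R) :
  exists f : {linear freeV R -> R^o},
    [/\ f 1 = 1, forall x y, f (x * y) = f x * f y & forall i, f (letter i) = X i].
Proof.
pose h (m : {fmonom 'I_3}) := \prod_(i <- m : seq 'I_3) X i.
have hM : mmorphism h.
  split=> [m1 m2|]; last by rewrite /h fm1 big_nil.
  by rewrite /h [mmul _ _]fmmulE big_cat.
pose h' : {mmorphism {fmonom 'I_3} -> R} := HB.pack h (isMultiplicative.Build _ _ h hM).
pose f (x : freeV R) : R^o := mmap idfun h' x.
have fl : linear f.
  move=> a x y; rewrite /f raddfD; congr (_ + _).
  exact: (mmapZ (f := idfun) (h := h') a x).
pose fL : {linear freeV R -> R^o} := HB.pack f (GRing.isLinear.Build _ _ _ _ f fl).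
exists fL; split=> [|x y|i]; rewrite /= /f.
- exact: rmorph1.
- exact: rmorphM.
- by rewrite mmapU mul1r /= /h fmuE big_seq1.
Qed.
End FreeAlgebra.

Section Sphere.
Context {R : comUnitRingType}.
Variables (q c : R).
Local Notation A := (sphere q c).
Local Notation u := (gen q c 0).
Local Notation v := (gen q c 1).
Local Notation w := (gen q c 2%:R).

Lemma sphere_ind_words (X : set A) :
  (forall a x y, X x -> X y -> X (a *: x + y)) ->
  (forall s : seq 'I_3, X (\prod_(i <- s) gen q c i)) -> forall x, X x.
Proof.
move=> XD Xw x; have [x' ->] := aqpi_surj x.
apply: (freeV_ind (X := [set y | X (aqpi _ y)])) => [a y z Xy Xz|s] /=.
  by rewrite linearP; apply: XD.
suff -> : aqpi (sphere_rel q c) (\prod_(i <- s) letter i) = \prod_(i <- s) gen q c i by [].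
by elim: s => [|i s IH]; rewrite ?big_nil ?big_cons // aqpiM IH.
Qed.

Lemma sphere_ind_mull (X : set A) :
  (forall a x y, X x -> X y -> X (a *: x + y)) -> X 1 ->
  (forall i x, X x -> X (gen q c i * x)) -> forall x, X x.
Proof.
move=> XD X1 XM; apply: sphere_ind_words => // s.
by elim: s => [|i s IH]; rewrite ?big_nil ?big_cons //; apply: XM.
Qed.

Lemma sphere_ind_mulr (X : set A) :
  (forall a x y, X x -> X y -> X (a *: x + y)) -> X 1 ->
  (forall i x, X x -> X (x * gen q c i)) -> forall x, X x.
Proof.
move=> XD X1 XM; apply: sphere_ind_words => // s.
elim/last_ind: s => [|s i IH]; rewrite ?big_nil // -cats1 big_cat big_seq1.
exact: XM.
Qed.

Lemma aqpi_quadratic t : aqpi (sphere_rel q c) (quadratic t) =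
  mx_eval (fun i j => gen q c i * gen q c j) t.
Proof.
rewrite linear_sum; apply: eq_bigr => i _; rewrite linear_sum.
by apply: eq_bigr => j _; rewrite linearZ /= aqpiM.
Qed.

Lemma sphere_spin1 t : spin q 1 t -> mx_eval (fun i j => gen q c i * gen q c j) t = 0.
Proof.
move=> t1; rewrite -aqpi_quadratic; apply: qpi_gen.
by left; exists t.
Qed.

Lemma sphere_vu : v * u = q ^+ 2 *: (u * v).
Proof.
apply/esym/eqP; rewrite -subr_eq0; apply/eqP.
rewrite -[RHS](@sphere_spin1 (q ^+ 2 *: delta_mx 0 1 - delta_mx 1 0)).
  by rewrite mx_evalD mx_evalN mx_evalZ !mx_eval_delta.
by apply: op_span_gen; left; left.
Qed.

Lemma sphere_uw : (q ^+ 3 + q) *: (u * w - w * u) + (1 - q ^+ 2) *: (v * v) = 0.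
Proof.
rewrite -[RHS](@sphere_spin1 ((q ^+ 3 + q) *: (delta_mx 0 2%:R - delta_mx 2%:R 0)
  + (1 - q ^+ 2) *: delta_mx 1 1)).
  by rewrite mx_evalD !mx_evalZ mx_evalD mx_evalN !mx_eval_delta.
by apply: op_span_gen; left; right.
Qed.

Lemma sphere_v0 : (q ^+ 3 + q) *: (u * w) + v * v + (q + q^-1) *: (w * u) = c *: (1 : A).
Proof.
apply/eqP; rewrite -subr_eq0; apply/eqP.
have -> : (q ^+ 3 + q) *: (u * w) + v * v + (q + q^-1) *: (w * u) =
    aqpi (sphere_rel q c) (quadratic (v0 q)).
  by rewrite aqpi_quadratic !mx_evalD !mx_evalZ !mx_eval_delta.
have -> : (c *: (1 : A)) = aqpi (sphere_rel q c) (c%:A) by rewrite linearZ.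
by rewrite -linearB; apply: qpi_gen; right.
Qed.

(** For commuting values with v = 0 the spin 1 relations hold trivially, and the
   relation for v_0 becomes a single equation for the value mu of w once u is
   sent to 1. *)
Lemma sphere_character (mu : R) : mu * (q ^+ 3 + q + (q + q^-1)) = c ->
  exists chi : {linear A -> R^o},
    [/\ chi 1 = 1, forall x y, chi (x * y) = chi x * chi y,
        chi u = 1, chi v = 0 & chi w = mu].
Proof.
move=> muc; pose X (i : 'I_3) : R := [:: 1; 0; mu]`_i.
have [f [f1 fM fX]] := freeV_eval X.
pose g : {linear 'M[R]_3 -> R^o} := mx_eval (fun i j => X i * X j : R^o).
have fquad t : f (quadratic t) = g t.
  rewrite linear_sum; apply: eq_bigr => i _; rewrite linear_sum.
  by apply: eq_bigr => j _; rewrite linearZ /= fM !fX.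
have gE t : g t = mx_eval (fun i j => X i * X j : R^o) t by [].
have f1t t : spin q 1 t -> f (quadratic t) = 0.
  rewrite fquad; apply: (op_span_lker (f := g)) => [s|[] //].
  case=> [[]|] ->; rewrite gE !(mx_evalD, mx_evalN, mx_evalZ, mx_eval_delta) /X /=.
  - by rewrite mulr0 mul0r scaler0 subr0.
  - by rewrite mul1r mulr1 mulr0 subrr !scaler0 addr0.
  - by rewrite mulr0 mul0r scaler0 subr0.
have f0 : forall x, op_span alg_mul (sphere_rel q c) x -> f x = 0.
  apply: op_span_lker => [x [[t t1 <-]|->]|[] a x /=].
  - exact: f1t.
  - rewrite linearB linearZ /= f1 fquad gE.
    rewrite !(mx_evalD, mx_evalZ, mx_eval_delta) /X /= -muc.
    by rewrite /GRing.scale /= !mul1r !mulr1 mulr0 addr0 -mulrDl mulrC subrr.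
  - by rewrite fM => ->; rewrite mulr0.
  - by rewrite fM => ->; rewrite mul0r.
have [chi chiE] := opquot_lift f0.
have chi_gen i : chi (gen q c i) = X i by rewrite -fX -chiE.
exists chi; split; rewrite ?chi_gen //; first by rewrite -f1 -chiE.
move=> x y; have [x' ->] := aqpi_surj x; have [y' ->] := aqpi_surj y.
by rewrite -aqpiM !chiE fM.
Qed.
End Sphere.

(** * Left multiplication on the cotangent bimodule *)

Section Cotangent.
Context {R : comUnitRingType}.
Variables (q c : R).
Local Notation A := (sphere q c).
Local Notation VAq := (VA q c).
Local Notation u := (gen q c 0).
Local Notation v := (gen q c 1).
Local Notation w := (gen q c 2%:R).

Lemma VA_sum (m : VAq) : m = \sum_j dtens j (m j).
Proof.
apply/ffunP => l; rewrite sum_ffunE (bigD1 l) //= ffunE eqxx big1 ?addr0 // => j.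
by rewrite ffunE eq_sym => /negbTE ->.
Qed.

Lemma dtens_linear j : linear (@dtens _ q c j).
Proof.
move=> a x y; apply/ffunP => l; rewrite !ffunE; case: ifP => // _.
by rewrite scaler0 addr0.
Qed.

Lemma mu23_mulr t (a b : A) : mu23 t (a * b) = VA_mul b (mu23 t a).
Proof. by apply/ffunP => i; rewrite !ffunE mulrA. Qed.

Lemma dtens_mulr j (a b : A) : dtens j (a * b) = VA_mul b (dtens j a).
Proof. by apply/ffunP => i; rewrite !ffunE; case: ifP => // _; rewrite mul0r. Qed.

Lemma Mr_v0 (a : A) : Mr (mu23 (v0 q) a).
Proof.
apply: op_span_gen; exists (v0 q); last by exists a.
exact: op_span_gen.
Qed.

Variable S : {linear 'M[R]_3 -> 'M[R]_3}.
Local Notation T := (cotangent q c S).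

(** The permutation rule moves x_i across dx_j, which is how x_i acts from the
   left on V' (x) A; the operator induces left multiplication on the bimodule
   (one_tens_left_act) but need not preserve M_r. *)
Definition left_act (i : 'I_3) (m : VAq) : VAq :=
  \sum_j mu23 (S (delta_mx i j)) (m j).

Definition one_tens (m : VAq) : T := cot_pi S (A_tens (1 : A) m).

Lemma cot_pi_linear : linear (cot_pi S : AVA q c -> T).
Proof. by move=> a x y; rewrite /cot_pi /cot_bar_pi !linearP. Qed.

Lemma A_tens_linearr (a : A) : linear (A_tens a).
Proof. by move=> k x y; apply: tensPr. Qed.

Lemma A_tens_linearl (m : VAq) a (x y : A) :
  A_tens (a *: x + y) m = a *: A_tens x m + A_tens y m.
Proof. exact: tensPl. Qed.

Lemma cot_pi_mul o (t : AVA q c) : cot_pi S (AVA_mul o t) = cot_mul S o (cot_pi S t).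
Proof.
apply/esym; etransitivity; first exact: qopE.
by rewrite /cot_pi; congr (qpi _ _ _); apply: qopE.
Qed.

Lemma AVA_mull (a b : A) m : AVA_mul (inl a) (A_tens b m) = A_tens (a * b) m.
Proof. exact: tmapE. Qed.

Lemma AVA_mulr (a b : A) m : AVA_mul (inr b) (A_tens a m) = A_tens a (VA_mul b m).
Proof. exact: tmapE. Qed.

Lemma one_tens_linear : linear one_tens.
Proof. by move=> a x y; rewrite /one_tens A_tens_linearr cot_pi_linear. Qed.
HB.instance Definition _ := GRing.isLinear.Build R VAq T *:%R one_tens one_tens_linear.

Lemma one_tens_mulr b m : one_tens (VA_mul b m) = cot_mul S (inr b) (one_tens m).
Proof. by rewrite /one_tens -AVA_mulr cot_pi_mul. Qed.

Lemma one_tens_Mr m : op_span (@VA_mul _ q c) (@Mr _ q c) m -> one_tens m = 0.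
Proof.
apply: (op_span_lker (f := one_tens)) => [x Mx|b x /= fx]; last first.
  by rewrite one_tens_mulr fx linear0.
rewrite /=.
rewrite /one_tens /cot_pi /cot_bar_pi.
have -> : qpi (@AVA_mul R q c) (@bar_rel R q c) (A_tens (1 : A) x) = 0.
  by apply: qpi_gen; right; exists (1 : A) => //; exists x.
exact: linear0.
Qed.

Lemma cot_pi_perm t : cot_pi S (AV_tens (mu12 1 t) 1) = one_tens (mu23 (S t) 1).
Proof.
apply/eqP; rewrite -subr_eq0; apply/eqP.
have cot_piB x y : cot_pi S x - cot_pi S y = cot_pi S (x - y).
  by rewrite /cot_pi /cot_bar_pi !linearB.
by rewrite cot_piB; apply: qpi_gen; exists t.
Qed.

Lemma mu12_1 (t : 'M[R]_3) l : mu12 (1 : A) t l = \sum_i t i l *: gen q c i.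
Proof. by rewrite ffunE; apply: mul1r. Qed.

Lemma A_tens0l (m : VAq) : A_tens (0 : A) m = 0.
Proof.
have := A_tens_linearl m (-1) 0 0.
by rewrite (scaler0 A) (addr0 (0 : A)) scaleN1r addNr.
Qed.

Lemma A_tensZl (m : VAq) a (x : A) : A_tens (a *: x) m = a *: A_tens x m.
Proof.
by have := A_tens_linearl m a x 0; rewrite A_tens0l !addr0.
Qed.

Lemma AV_tens_mu12_delta i j :
  AV_tens (mu12 (1 : A) (delta_mx i j)) 1 = A_tens (gen q c i) (dtens j 1).
Proof.
rewrite /AV_tens (bigD1 j) //= mu12_1 sum_delta_mx eqxx big1 ?addr0 // => l lj.
rewrite mu12_1 sum_delta_mx (negbTE lj); exact: A_tens0l.
Qed.

(** The defining relations of the bimodule read with t = x_i (x) dx_j and then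
   multiplied by A on the right. *)
Lemma cot_pi_gen i m : cot_pi S (A_tens (gen q c i) m) = one_tens (left_act i m).
Proof.
rewrite [m in LHS]VA_sum /left_act linear_sum.
pose f m := cot_pi S (A_tens (gen q c i) m).
have fl : linear f by move=> a x y; rewrite /f A_tens_linearr cot_pi_linear.
pose fL : {linear VAq -> T} := HB.pack f (GRing.isLinear.Build _ _ _ _ f fl).
rewrite -[LHS]/(fL _) linear_sum; apply: eq_bigr => j _ /=.
rewrite -[m j]mul1r dtens_mulr mu23_mulr one_tens_mulr -cot_pi_perm -cot_pi_mul.
rewrite AV_tens_mu12_delta.
by rewrite AVA_mulr.
Qed.

Lemma one_tens_left_act i m :
  one_tens (left_act i m) = cot_mul S (inl (gen q c i)) (one_tens m).
Proof. by rewrite -cot_pi_mul AVA_mull mulr1 cot_pi_gen. Qed.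

Lemma cot_piZ a (t : AVA q c) : cot_pi S (a *: t) = a *: cot_pi S t.
Proof. by rewrite /cot_pi /cot_bar_pi !linearZ. Qed.

Lemma one_tens_left_act2 i j m :
  cot_pi S (A_tens (gen q c i * gen q c j) m) = one_tens (left_act i (left_act j m)).
Proof. by rewrite -AVA_mull cot_pi_mul cot_pi_gen -one_tens_left_act. Qed.

(** Elements a (x) m with a a word are reduced by moving the letters of a to the
   right one at a time. *)
Lemma one_tens_surj (y : T) : exists m, y = one_tens m.
Proof.
have [y1 ->] := qpi_surj y; have [t ->] := qpi_surj y1 => {y y1}.
apply: (tensor_ind (X := [set t | exists m, cot_pi S t = one_tens m])) => [|a m].
  split=> [|a x x' [m xm] [m' xm']|[] //].
    exists 0; rewrite linear0 /cot_pi /cot_bar_pi.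
    by rewrite (linear0 (qpi (@AVA_mul R q c) (@bar_rel R q c))) linear0.
  by exists (a *: m + m'); rewrite cot_pi_linear xm xm' linearP.
apply: (sphere_ind_mull (X := fun a => exists m', cot_pi S (A_tens a m) = one_tens m'))
  => [b x y||i x].
- move=> [m1 E1] [m2 E2]; exists (b *: m1 + m2).
  rewrite (A_tens_linearl m b x y) cot_pi_linear one_tens_linear.
  by apply: (congr2 (fun p r => b *: p + r)); [exact: E1|exact: E2].
- by exists m.
- by case=> m' E; exists (left_act i m'); rewrite -AVA_mull cot_pi_mul E one_tens_left_act.
Qed.
End Cotangent.

(** * Covariant operators in coordinates *)

Section Eigen.
Context {R : comUnitRingType}.
Variables (q x y z : R) (S : {linear 'M[R]_3 -> 'M[R]_3}).

(** The operator x P_0 + y P_1 + z P_2 described without the projectors, which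
   avoids inverting q^2 + 1, q^4 + 1 and q^4 + q^2 + 1. *)
Definition eigen_op : Prop :=
  [/\ forall t, spin q 0 t -> S t = x *: t,
      forall t, spin q 1 t -> S t = y *: t
    & forall t, spin q 2%:R t -> S t = z *: t].

Hypothesis Sq : eigen_op.

Local Notation e := (fun i j => delta_mx i j : 'M[R]_3).

(** The entries of (q^4 + 1) S on the weight 2 plane spanned by uv and vu; S is
   symmetric there, so that uv_vu occurs twice. *)
Definition uv_uv := q ^+ 4 * y + z.
Definition uv_vu := q ^+ 2 * (z - y).
Definition vu_vu := y + q ^+ 4 * z.
(** The coefficient with which du survives in obstruction_du. *)
Definition du_coef := q ^+ 2 * y + (1 - q ^+ 2 + q ^+ 4) * z.

Lemma eigen_uu : S (e 0 0) = z *: e 0 0.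
Proof. by case: Sq => _ _; apply; apply: op_span_gen; do 4!left. Qed.

Lemma eigen_uv_spin1 : S (q ^+ 2 *: e 0 1 - e 1 0) = y *: (q ^+ 2 *: e 0 1 - e 1 0).
Proof. by case: Sq => _ + _; apply; apply: op_span_gen; left; left. Qed.

Lemma eigen_uv_spin2 : S (e 0 1 + q ^+ 2 *: e 1 0) = z *: (e 0 1 + q ^+ 2 *: e 1 0).
Proof. by case: Sq => _ _; apply; apply: op_span_gen; left; left; left; right. Qed.

Lemma eigen_v0 : S (v0 q) = x *: v0 q.
Proof. by case: Sq => + _ _; apply; apply: op_span_gen. Qed.

Definition spin1_w0 : 'M[R]_3 := (q ^+ 3 + q) *: (e 0 2%:R - e 2%:R 0) + (1 - q ^+ 2) *: e 1 1.
Definition spin2_w0 : 'M[R]_3 := e 0 2%:R - q *: e 1 1 + q ^+ 4 *: e 2%:R 0.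

Lemma eigen_spin1_w0 : S spin1_w0 = y *: spin1_w0.
Proof. by case: Sq => _ + _; apply; apply: op_span_gen; left; right. Qed.

Lemma eigen_spin2_w0 : S spin2_w0 = z *: spin2_w0.
Proof. by case: Sq => _ _; apply; apply: op_span_gen; left; left; right. Qed.

Lemma eigen_uv : (q ^+ 4 + 1) *: S (e 0 1) = uv_uv *: e 0 1 + uv_vu *: e 1 0.
Proof.
rewrite -linearZ /=.
have -> : (q ^+ 4 + 1) *: e 0 1 =
    q ^+ 2 *: (q ^+ 2 *: e 0 1 - e 1 0) + (e 0 1 + q ^+ 2 *: e 1 0).
  by apply/matrixP => i j; rewrite !mxE; ring.
rewrite linearP eigen_uv_spin1 eigen_uv_spin2.
by apply/matrixP => i j; rewrite !mxE /uv_uv /uv_vu; ring.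
Qed.

Lemma eigen_vu : (q ^+ 4 + 1) *: S (e 1 0) = uv_vu *: e 0 1 + vu_vu *: e 1 0.
Proof.
rewrite -linearZ /=.
have -> : (q ^+ 4 + 1) *: e 1 0 =
    (- 1) *: (q ^+ 2 *: e 0 1 - e 1 0) + q ^+ 2 *: (e 0 1 + q ^+ 2 *: e 1 0).
  by apply/matrixP => i j; rewrite !mxE; ring.
rewrite linearP linearZ /= eigen_uv_spin1 eigen_uv_spin2.
by apply/matrixP => i j; rewrite !mxE /uv_vu /vu_vu; ring.
Qed.

(** uw_den is a common denominator for the spin components of uw, uw_cofactor is
   uw_den / (q^4 + 1), and uw_comp0, uw_comp1, uw_comp2 are the components of
   uw_den S(uw) along v0, spin1_w0 and spin2_w0. *)
Definition uw_cofactor := (q ^+ 2 + 1) * (q ^+ 4 + q ^+ 2 + 1).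
Definition uw_den := (q ^+ 4 + 1) * uw_cofactor.
Definition uw_comp0 := x * (q ^+ 3 * (q ^+ 4 + 1)).
Definition uw_comp1 := y * (q * (q ^+ 4 + q ^+ 2 + 1)).
Definition uw_comp2 := z * (q ^+ 2 + 1).

Lemma eigen_uw : q * q^-1 = 1 -> uw_den *: S (e 0 2%:R) =
  uw_comp0 *: v0 q + uw_comp1 *: spin1_w0 + uw_comp2 *: spin2_w0.
Proof.
move=> qV; rewrite -linearZ /=.
have -> : uw_den *: e 0 2%:R = (q ^+ 3 * (q ^+ 4 + 1)) *: v0 q +
    ((q * (q ^+ 4 + q ^+ 2 + 1)) *: spin1_w0 + (q ^+ 2 + 1) *: spin2_w0).
  by apply/matrixP => i j; rewrite !mxE /uw_den /uw_cofactor; ring: qV.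
rewrite 2!linearP linearZ /= eigen_spin1_w0 eigen_spin2_w0 eigen_v0 !scalerA addrA.
by congr (_ *: _ + _ *: _ + _ *: _); rewrite mulrC.
Qed.
End Eigen.

(** * Elimination in the weight spaces *)

Section Identities.
Context {R : comUnitRingType} {V : lmodType R}.
Variables (q x y z : R).
Hypothesis qV : q * q^-1 = 1.

(** The computation behind obstruction_du.  The names stand for the classes
   uw = du uw, vv = du vv, wu = du wu, uv = dv uv, uu = dw uu and o = c du, while
   H0, H1, H2 are u du w, u dv v and u dw u.  Subtracting from the last premise
   suitable multiples of the spin 1 relation of A and of the relation v_0 u = 0
   leaves only o. *)
Lemma v0_row_elim (uw vv wu uv uu o H0 H1 H2 : V) :
  let al := q ^+ 3 + q in let be := q + q^-1 in let vu := q ^+ 2 *: uv in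
  al *: uw + vv + be *: wu = o ->
  al *: (uw - wu) + (1 - q ^+ 2) *: vv = 0 ->
  al *: wu + vu + be *: uu = 0 ->
  H0 = z *: uw ->
  (q ^+ 4 + 1) *: H1 = uv_uv q y z *: vv + uv_vu q y z *: uv ->
  uw_den q *: H2 = uw_comp0 q x *: (al *: wu + vu + be *: uu)
    + uw_comp1 q y *: (al *: (wu - uu) + (1 - q ^+ 2) *: vu)
    + uw_comp2 q z *: (wu - q *: vu + q ^+ 4 *: uu) ->
  al *: H0 + H1 + be *: H2 = 0 ->
  (uw_cofactor q * du_coef q y z) *: o = 0.
Proof.
move=> al be vu uwE rel_uw rel_v0 H0E H1E H2E total0.
(* the coefficient of uu in uw_den *: H2 *)
pose cuu := uw_comp0 q x * be - uw_comp1 q y * al + uw_comp2 q z * q ^+ 4.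
transitivity (uw_den q *: (al *: H0 + H1 + be *: H2)
    - (z * uw_den q - uw_cofactor q * du_coef q y z) *: (al *: (uw - wu) + (1 - q ^+ 2) *: vv)
    - cuu *: (al *: wu + vu + be *: uu)); last first.
  by rewrite total0 rel_uw rel_v0 !scaler0 !subr0.
rewrite -uwE ![uw_den q *: (_ + _)]scalerDr H0E.
have -> : uw_den q *: (be *: H2) = be *: (uw_den q *: H2) by rewrite !scalerA mulrC.
have -> : uw_den q *: H1 = uw_cofactor q *: ((q ^+ 4 + 1) *: H1) by rewrite scalerA mulrC.
rewrite H1E H2E.
(* Both sides are combinations of the same five vectors, hence values of one
   linear map mx_eval F at two matrices, which agree entry by entry. *)
pose F (i j : 'I_3) : V :=
  nth 0 (nth [::] [:: [:: uw; vv; wu]; [:: uv]; [:: uu]] i) j.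
have -> : uw = F 0 0 by []. have -> : vv = F 0 1 by []. have -> : wu = F 0 2%:R by [].
rewrite /vu; have -> : uv = F 1 0 by []. have -> : uu = F 2%:R 0 by [].
move: F => F; rewrite -!(mx_eval_delta F) -!(mx_evalN, mx_evalZ, mx_evalD).
congr (mx_eval F _); apply/matrixP => i j; rewrite !mxE.
rewrite /cuu /du_coef /uw_comp0 /uw_comp1 /uw_comp2 /uw_den /uw_cofactor /uv_uv /uv_vu /al /be.
ring: qV.
Qed.

(** The computation behind obstruction_V2.  Here uv = du uv, uu = dv uu, while
   P01 and P10 are u v du and v u du, and L0, L1, N are u du v, u dv u and
   v du u. *)
Lemma vu_elim (uv uu P01 P10 L0 L1 N : V) :
  let vu := q ^+ 2 *: uv in
  (q ^+ 4 + 1) *: P01 = uv_vu q y z *: L0 + vu_vu q y z *: L1 ->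
  L0 = z *: uv ->
  (q ^+ 4 + 1) *: L1 = uv_uv q y z *: vu + uv_vu q y z *: uu ->
  P10 = z *: N ->
  (q ^+ 4 + 1) *: N = uv_vu q y z *: vu + vu_vu q y z *: uu ->
  P10 = q ^+ 2 *: P01 ->
  (uv_uv q y z * vu_vu q y z) *: (q ^+ 4 *: uv - uu) = 0.
Proof.
move=> vu P01E L0E L1E P10E NE PP; set D := q ^+ 4 + 1 in P01E L1E NE.
have E1 : D *: (D *: P01) = (uv_vu q y z * D * z) *: uv
    + vu_vu q y z *: (uv_uv q y z *: vu + uv_vu q y z *: uu).
  by rewrite P01E L0E scalerDr -L1E !scalerA; congr (_ *: _ + _ *: _); ring.
have E2 : D *: (D *: P10) = (D * z) *: (uv_vu q y z *: vu + vu_vu q y z *: uu).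
  by rewrite P10E -NE !scalerA; congr (_ *: _); ring.
have : q ^+ 2 *: (D *: (D *: P01)) - D *: (D *: P10) = 0.
  by rewrite PP !scalerA; apply/eqP; rewrite subr_eq0; apply/eqP; congr (_ *: _); ring.
rewrite E1 E2 => <-.
pose F (i j : 'I_3) : V := if i == 0 then uv else uu.
rewrite /vu; have -> : uv = F 0 0 by []. have -> : uu = F 1 0 by [].
move: F => F; rewrite -!(mx_eval_delta F) -!(mx_evalN, mx_evalZ, mx_evalD).
congr (mx_eval F _); apply/matrixP => i j; rewrite !mxE /D /uv_uv /uv_vu /vu_vu.
ring.
Qed.
End Identities.

(** * The two obstructions *)

Section Action.
Context {R : comUnitRingType}.
Variables (q c : R).
Local Notation A := (sphere q c).
Local Notation VAq := (VA q c).
Local Notation u := (gen q c 0).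
Local Notation v := (gen q c 1).
Local Notation w := (gen q c 2%:R).

Lemma sphere_mulr_suml (a : A) (F : 'I_3 -> A) : (\sum_l F l) * a = \sum_l F l * a.
Proof. by rewrite !big_ord3 !mulrDl. Qed.

Lemma mu23E t (a : A) : mu23 t a = mx_eval (fun k l => dtens k (gen q c l * a)) t.
Proof.
apply/ffunP => i; pose ev (m : VAq) : A := m i.
have ev_linear : linear ev by move=> a' m m'; rewrite /ev !ffunE.
pose evL : {linear VAq -> A} := HB.pack ev (GRing.isLinear.Build _ _ _ _ ev ev_linear).
rewrite -[RHS]/(evL _) mx_eval_comp ffunE sphere_mulr_suml /mx_eval [RHS](bigD1 i) //=.
rewrite [X in _ = _ + X]big1 ?addr0 => [|k ki].
  by apply: eq_bigr => l _; rewrite -aq_scalerAl /ev ffunE eqxx.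
rewrite big1 // => l _; rewrite /ev ffunE eq_sym (negbTE ki).
exact: scaler0.
Qed.

Variable S : {linear 'M[R]_3 -> 'M[R]_3}.

Lemma mu23_linearr t : linear (@mu23 _ q c t).
Proof.
by move=> k a b; apply/ffunP => i; rewrite !ffunE mulrDr aq_scalerAr.
Qed.

Lemma left_act_linear i : linear (left_act S i : VAq -> VAq).
Proof.
move=> k m m'; rewrite /left_act scaler_sumr -big_split; apply: eq_bigr => j _.
by rewrite !ffunE mu23_linearr.
Qed.
HB.instance Definition _ i :=
  GRing.isLinear.Build R VAq VAq *:%R (left_act S i) (left_act_linear i).

Lemma one_tens_left_actZ i a (m : VAq) :
  one_tens S (left_act S i (a *: m)) = a *: one_tens S (left_act S i m).
Proof. by rewrite !linearZ. Qed.

Lemma one_tens_left_act_lin2 i a b (m m' : VAq) :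
  one_tens S (left_act S i (a *: m + b *: m')) =
    a *: one_tens S (left_act S i m) + b *: one_tens S (left_act S i m').
Proof. by rewrite !linearP !linearZ. Qed.

Lemma one_tens_left_act_lin3 i a b (m m' m'' : VAq) :
  one_tens S (left_act S i (a *: m + m' + b *: m'')) =
    a *: one_tens S (left_act S i m) + one_tens S (left_act S i m')
    + b *: one_tens S (left_act S i m'').
Proof. by rewrite !linearD !linearZ. Qed.

Lemma left_act_dtens i j (a : A) : left_act S i (dtens j a) = mu23 (S (delta_mx i j)) a.
Proof.
rewrite /left_act (bigD1 j) //= ffunE eqxx big1 ?addr0 // => l lj.
rewrite ffunE (negbTE lj); have := mu23_linearr (S (delta_mx i l)) (-1) 0 0.
by rewrite (scaler0 A) (addr0 (0 : A)) scaleN1r addNr.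
Qed.

Definition dx (k : 'I_3) (a : A) : cotangent q c S := one_tens S (dtens k a).

Lemma dx_linear k : linear (dx k).
Proof. by move=> b a a'; rewrite /dx dtens_linear one_tens_linear. Qed.
HB.instance Definition _ k :=
  GRing.isLinear.Build R A (cotangent q c S) *:%R (dx k) (dx_linear k).

Lemma one_tens_mu23 t (a : A) :
  one_tens S (mu23 t a) = mx_eval (fun k l => dx k (gen q c l * a)) t.
Proof. by rewrite mu23E mx_eval_comp. Qed.

Lemma one_tens_left_act_dtens i j (a : A) :
  one_tens S (left_act S i (dtens j a)) =
    mx_eval (fun k l => dx k (gen q c l * a)) (S (delta_mx i j)).
Proof. by rewrite left_act_dtens one_tens_mu23. Qed.

Lemma dx_mulr k (a b : A) : dx k (a * b) = cot_mul S (inr b) (dx k a).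
Proof. by rewrite /dx dtens_mulr one_tens_mulr. Qed.

Lemma one_tens_v0 (a : A) : one_tens S (mu23 (v0 q) a) = 0.
Proof. by apply: one_tens_Mr; apply: op_span_gen; apply: Mr_v0. Qed.

Lemma dx_v0 (a : A) :
  (q ^+ 3 + q) *: dx 0 (w * a) + dx 1 (v * a) + (q + q^-1) *: dx 2%:R (u * a) = 0.
Proof.
rewrite -(one_tens_v0 a) one_tens_mu23.
by rewrite !mx_evalD !mx_evalZ !mx_eval_delta.
Qed.

Variables (x y z : R).
Hypothesis Sq : eigen_op q x y z S.
Hypothesis qV : q * q^-1 = 1.

Lemma dxD k (a b : A) : dx k (a + b) = dx k a + dx k b.
Proof. exact: linearD. Qed.
Lemma dxB k (a b : A) : dx k (a - b) = dx k a - dx k b.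
Proof. exact: linearB. Qed.
Lemma dxZ k r (a : A) : dx k (r *: a) = r *: dx k a.
Proof. exact: linearZ. Qed.
Lemma dx0 k : dx k 0 = 0.
Proof. exact: linear0. Qed.

Lemma dx_vu k : dx k (v * u) = q ^+ 2 *: dx k (u * v).
Proof. by rewrite sphere_vu dxZ. Qed.

(** M_r need not be stable under left_act, but its image is zero in the bimodule and so
   is the image of every left translate. *)
Lemma one_tens_left_act_v0 i :
  (q ^+ 3 + q) *: one_tens S (left_act S i (dtens 0 w)) + one_tens S (left_act S i (dtens 1 v))
  + (q + q^-1) *: one_tens S (left_act S i (dtens 2%:R u)) = 0.
Proof.
have <- : one_tens S (left_act S i (mu23 (v0 q) (1 : A))) = 0.
  by rewrite one_tens_left_act one_tens_v0 linear0.
have -> : mu23 (v0 q) (1 : A) =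
    (q ^+ 3 + q) *: dtens 0 w + dtens 1 v + (q + q^-1) *: dtens 2%:R u.
  by rewrite mu23E !mx_evalD !mx_evalZ !mx_eval_delta !mulr1.
exact/esym/one_tens_left_act_lin3.
Qed.

(** The factor c comes from the relation v_0 = c of the sphere, which turns the
   degree 2 vector of spin 1 into a multiple of du. *)
Lemma obstruction_du :
  (uw_cofactor q * du_coef q y z * c) *: dx 0 1 = 0.
Proof.
rewrite -scalerA.
apply: (@v0_row_elim _ _ q x y z qV (dx 0 (u * w)) (dx 0 (v * v)) (dx 0 (w * u))
  (dx 1 (u * v)) (dx 2%:R (u * u)) _ (one_tens S (left_act S 0 (dtens 0 w)))
  (one_tens S (left_act S 0 (dtens 1 v))) (one_tens S (left_act S 0 (dtens 2%:R u)))).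
- by rewrite -!dxZ -!dxD sphere_v0.
- by rewrite -dxB -!dxZ -dxD sphere_uw dx0.
- by rewrite -dx_vu; apply: dx_v0.
- by rewrite one_tens_left_act_dtens (eigen_uu Sq) mx_evalZ mx_eval_delta.
- rewrite one_tens_left_act_dtens -mx_evalZ (eigen_uv Sq) mx_evalD !mx_evalZ.
  by rewrite !mx_eval_delta.
- rewrite one_tens_left_act_dtens -mx_evalZ (eigen_uw Sq qV) -dx_vu.
  by rewrite !(mx_evalD, mx_evalN, mx_evalZ, mx_eval_delta).
- exact: one_tens_left_act_v0.
Qed.

(** The vector has spin 2: in V' (x) A it is the highest weight vector of the copy
   of V_2 inside V' (x) V_2. *)
Lemma obstruction_V2 :
  (uv_uv q y z * vu_vu q y z) *: (q ^+ 4 *: dx 0 (u * v) - dx 1 (u * u)) = 0.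
Proof.
apply: (@vu_elim _ _ q y z _ _ (one_tens S (left_act S 0 (left_act S 1 (dtens 0 1))))
  (one_tens S (left_act S 1 (left_act S 0 (dtens 0 1))))
  (one_tens S (left_act S 0 (dtens 0 v)))
  (one_tens S (left_act S 0 (dtens 1 u))) (one_tens S (left_act S 1 (dtens 0 u)))).
- rewrite left_act_dtens -one_tens_left_actZ.
  have -> : (q ^+ 4 + 1) *: mu23 (S (delta_mx 1 0)) (1 : A) =
      uv_vu q y z *: dtens 0 v + vu_vu q y z *: dtens 1 u.
    by rewrite mu23E -mx_evalZ (eigen_vu Sq) mx_evalD !mx_evalZ !mx_eval_delta !mulr1.
  exact: one_tens_left_act_lin2.
- by rewrite one_tens_left_act_dtens (eigen_uu Sq) mx_evalZ mx_eval_delta.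
- rewrite one_tens_left_act_dtens -mx_evalZ (eigen_uv Sq) mx_evalD !mx_evalZ.
  by rewrite !mx_eval_delta dx_vu.
- rewrite [left_act S 0 _]left_act_dtens (eigen_uu Sq) mu23E mx_evalZ mx_eval_delta mulr1.
  exact: one_tens_left_actZ.
- rewrite one_tens_left_act_dtens -mx_evalZ (eigen_vu Sq) mx_evalD !mx_evalZ.
  by rewrite !mx_eval_delta dx_vu.
- by rewrite -!one_tens_left_act2 sphere_vu A_tensZl cot_piZ.
Qed.
End Action.

(** * The two coefficients cannot both vanish *)

Lemma transposition_eigen {R : comUnitRingType} (q : R) S : transposition q S ->
  exists x y z, eigen_op q x y z S.
Proof.
move=> [_ [P [x [y [z [PP SE]]]]]]; exists x, y, z.
by split=> t st; rewrite SE (PP 0 _ _ st) (PP 1 _ _ st) (PP 2%:R _ _ st) /=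
  !scaler0 ?add0r ?addr0.
Qed.

Lemma eigen_z_neq0 {R : comUnitRingType} (q x y z : R) (S : {linear 'M[R]_3 -> 'M[R]_3}) :
  eigen_op q x y z S -> injective S -> z != 0.
Proof.
move=> Sq Sinj; apply/eqP => z0.
have /Sinj /matrixP/(_ 0 0)/eqP : S (delta_mx 0 0) = S 0.
  by rewrite (eigen_uu Sq) z0 scale0r linear0.
by rewrite !mxE /= oner_eq0.
Qed.

(** When du_coef vanishes, both factors uv_uv and vu_vu of the other coefficient
   are z kappa up to a sign and a power of q. *)
Definition kappa {R : comNzRingType} (q : R) : R := (q ^+ 2 - 1) * (q ^+ 4 + 1).

Lemma spin2_coef {R : comUnitRingType} (q y z : R) : du_coef q y z = 0 ->
  q ^+ 2 * (uv_uv q y z * vu_vu q y z) = - (z * kappa q) * (z * kappa q).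
Proof.
move=> p0; transitivity
  ((q ^+ 2 * du_coef q y z - z * kappa q) * (du_coef q y z + z * kappa q)).
  by rewrite /uv_uv /vu_vu /kappa /du_coef; ring.
by rewrite p0 mulr0 !add0r.
Qed.

(** * The fibre at a character *)

Section Fibre.
Context {R : comUnitRingType}.
Variables (q c mu : R).
Hypothesis mu_c : mu * (q ^+ 3 + q + (q + q^-1)) = c.
Local Notation A := (sphere q c).
Local Notation u := (gen q c 0).
Local Notation v := (gen q c 1).
Local Notation w := (gen q c 2%:R).

(** The images of du, dv, dw under a map k^3 -> k^2 that kills
   (q^3 + q) mu du + (q + q^-1) dw, the value of v_0 at the character. *)
Definition fibre_vec (j : 'I_3) : (R^o * R^o)%type :=
  nth 0 [:: (q + q^-1, 0); (0, 1); (- ((q ^+ 3 + q) * mu), 0)] j.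

Lemma cotangent_fibre :
  exists (chi : {linear A -> R^o}) (f : {linear VA q c -> (R^o * R^o)%type}),
  [/\ [/\ chi 1 = 1, forall a b, chi (a * b) = chi a * chi b,
          chi u = 1, chi v = 0 & chi w = mu],
      forall j a, f (dtens j a) = chi a *: fibre_vec j,
      forall b m, f (VA_mul b m) = chi b *: f m
    & forall m, op_span (@VA_mul _ q c) (@Mr _ q c) m -> f m = 0].
Proof.
have [chi [chi1 chiM chiu chiv chiw]] := sphere_character mu_c.
pose f (m : VA q c) := \sum_j chi (m j) *: fibre_vec j.
have f_linear : linear f.
  move=> a m m'; rewrite /f scaler_sumr -big_split; apply: eq_bigr => j _.
  by rewrite !ffunE linearP scalerDl scalerA.
pose fL : {linear VA q c -> (R^o * R^o)%type} :=
  HB.pack f (GRing.isLinear.Build _ _ _ _ f f_linear).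
have f_dtens j a : fL (dtens j a) = chi a *: fibre_vec j.
  rewrite /= /f (bigD1 j) //= ffunE eqxx big1 ?addr0 // => l lj.
  by rewrite ffunE (negbTE lj) linear0 scale0r.
have f_mul b m : fL (VA_mul b m) = chi b *: fL m.
  rewrite /= /f scaler_sumr; apply: eq_bigr => j _.
  by rewrite ffunE chiM scalerA mulrC.
exists chi, fL; split=> //; apply: op_span_lker => [m|b m fm]; last first.
  by rewrite f_mul fm scaler0.
apply: (op_span_lker (f := fL)) => [_ [t t0 [a _ <-]]|[] //].
rewrite mu23E mx_eval_comp.
pose F i j := fL (dtens i (gen q c j * a)).
apply: (op_span_lker (f := mx_eval F) _ _ t0) => [_ ->|[] //].
rewrite /= !mx_evalD !mx_evalZ !mx_eval_delta /F !f_dtens !chiM chiu chiv chiw.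
rewrite !mul0r scale0r addr0 /fibre_vec /=.
congr pair; rewrite /= /GRing.scale /=; last by rewrite !mulr0 addr0.
ring.
Qed.
End Fibre.

(** * The fibre of the classical bimodule *)

Section Classical.
Context {R : comUnitRingType}.
Variables (c mu : R).
Hypothesis mu_c : mu * (1 ^+ 3 + 1 + (1 + 1^-1)) = c.
Local Notation A := (sphere 1 c).
Local Notation P := (R^o * R^o)%type.

Definition gen_value (i : 'I_3) : R := nth 0 [:: 1; 0; mu] i.
Definition letter_value (o : 'I_3 + 'I_3) : R :=
  match o with inl i => gen_value i | inr i => gen_value i end.

(** For the flip, left and right multiplication by a letter agree on the fibre, so
   a (x) m can be sent to chi(a) f(m), with f the fibre map of the right cotangent
   module.  The relations of M_l hold because at q = 1 the vector v_0 is symmetric,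
   and the permutation relations because the flip is the transpose. *)
Lemma classical_fibre : exists L : {linear cotangent 1 c flip -> P},
  (forall o t, L (@cot_letter_mul _ 1 c flip o t) = letter_value o *: L t) /\
  (forall j, L (one_tens flip (dtens j 1)) = fibre_vec 1 mu j).
Proof.
have [chi [f [[chi1 chiM chiu chiv chiw] f_dtens f_mul f_Mr]]] := cotangent_fibre mu_c.
have chi_gen : forall i, chi (gen 1 c i) = gen_value i by apply: ord3P.
have [|m|g gE] := @tensor_lift _ A (VA 1 c) P (fun a m => chi a *: f m).
- by move=> m r a b; rewrite linearP scalerDl scalerA.
- by move=> r m' m''; rewrite linearP scalerDr !scalerA mulrC.
pose chi2 (o : A + A) : R := match o with inl a => chi a | inr a => chi a end.
have g_tens a m : g (A_tens a m) = chi a *: f m by exact: gE.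
have g_mul_tens o a m : g (AVA_mul o (A_tens a m)) = chi2 o *: g (A_tens a m).
  have -> : chi2 o *: g (A_tens a m) = (chi2 o * chi a) *: f m.
    by rewrite g_tens scalerA.
  case: o => b.
    rewrite AVA_mull; apply: etrans (g_tens _ _) _.
    by congr (_ *: _); exact: chiM.
  rewrite AVA_mulr; apply: etrans (g_tens _ _) _.
  rewrite f_mul scalerA; congr (_ *: _); exact: mulrC.
have g_mul o t : g (AVA_mul o t) = chi2 o *: g t.
  apply: (tensor_ind (X := [set t | g (AVA_mul o t) = chi2 o *: g t])).
    split=> [|r x y /= gx gy|[] //]; first by rewrite /= (linear0 (AVA_mul o)) linear0 scaler0.
    by rewrite (linearP (AVA_mul o)) !(linearP g) gx gy scalerDr !scalerA mulrC.
  move=> a m; exact: g_mul_tens.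
have f_sum m : f m = \sum_j chi (m j) *: fibre_vec 1 mu j.
  by rewrite {1}[m]VA_sum linear_sum; apply: eq_bigr => j _; apply: f_dtens.
have g_AV m b : g (AV_tens m b) = chi b *: f m.
  rewrite f_sum scaler_sumr linear_sum; apply: eq_bigr => j _.
  by rewrite g_tens f_dtens !scalerA mulrC.
have f_mu12 a t : f (mu12 a t) =
    chi a *: mx_eval (fun i j => gen_value i *: fibre_vec 1 mu j) t.
  rewrite f_sum /mx_eval exchange_big scaler_sumr.
  apply: eq_bigr => j _; rewrite ffunE chiM -scalerA linear_sum scaler_suml.
  by congr (_ *: _); apply: eq_bigr => i _; rewrite linearZ /= chi_gen scalerA.
have g_bar : forall t, op_span (@AVA_mul _ 1 c) (@bar_rel _ 1 c) t -> g t = 0.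
  apply: op_span_lker => [t [[m Mm [b _ <-]]|[a _ [m Mm <-]]]|o t gt].
  - rewrite g_AV; have -> : f m = 0; last exact: scaler0.
    apply: (op_span_lker (f := f) _ _ Mm) => [_ [a _ [s s0 <-]]|[] //].
    rewrite f_mu12; pose h := mx_eval (fun i j => gen_value i *: fibre_vec 1 mu j).
    rewrite -/h.
    have -> : h s = 0; last exact: scaler0.
    apply: (op_span_lker (f := h) _ _ s0) => [_ ->|[] //].
    rewrite -[LHS]/(h _) /h !mx_evalD !mx_evalZ !mx_eval_delta /gen_value /fibre_vec /=.
    rewrite scale0r addr0 scale1r; congr pair; rewrite /= /GRing.scale /=; last by ring.
    by rewrite expr1n invr1; ring.
  - by rewrite g_tens f_Mr ?scaler0 //; apply: op_span_gen.
  - by rewrite g_mul gt scaler0.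
have [g1 g1E'] := opquot_lift g_bar.
have g1E t : g1 (cot_bar_pi t) = g t := g1E' t.
have g1_mul o t : g1 (cot_bar_mul o t) = chi2 o *: g1 t.
  have [t' ->] := qpi_surj t.
  have -> : cot_bar_mul o (qpi (@AVA_mul _ 1 c) (@bar_rel _ 1 c) t') =
      cot_bar_pi (AVA_mul o t').
    exact: qopE.
  by rewrite g1E g_mul g1E'.
have g1_perm : forall t, op_span (@cot_bar_mul _ 1 c) (permutation_rel flip) t -> g1 t = 0.
  apply: op_span_lker => [_ [t _ <-]|o t gt]; last by rewrite g1_mul gt scaler0.
  rewrite g1E linearB /= g_AV g_tens; apply/eqP; rewrite subr_eq0; apply/eqP.
  congr (_ *: f _); apply/ffunP => j; rewrite !ffunE mul1r mulr1.
  by apply: eq_bigr => i _; rewrite mxE.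
have [L LE] := opquot_lift g1_perm.
exists L; split=> [o t|j].
  have [t' ->] := qpi_surj t.
  have -> : @cot_letter_mul _ 1 c flip o (qpi (@cot_bar_mul _ 1 c) (permutation_rel flip) t') =
    qpi (@cot_bar_mul _ 1 c) (permutation_rel flip)
      (cot_bar_mul match o with inl i => inl (gen 1 c i) | inr i => inr (gen 1 c i) end t').
    exact: qopE.
  by rewrite !LE g1_mul; case: o => i /=; rewrite chi_gen.
by rewrite /one_tens /cot_pi LE g1E g_tens f_dtens chi1 !scale1r.
Qed.
End Classical.

(** * Generic q *)

Lemma scale_cancel {k : fieldType} {V : lmodType k} (a : k) (t : V) :
  a != 0 -> a *: t = 0 -> t = 0.
Proof. by move=> a0 /eqP; rewrite scaler_eq0 (negbTE a0) => /eqP. Qed.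

Section Generic.
Context {k : fieldType}.
Implicit Types q c : k.

Definition exceptional : set k := [set 0] `|` [set z | exists2 n, (0 < n)%N & z ^+ n = 1].

Lemma finite_roots (p : {poly k}) : p != 0 -> finite_set [set z | root p z].
Proof.
have [n] := ubnP (size p); elim: n p => // n IH p; rewrite ltnS => szp p0.
have [[a pa]|noroot] := pselect (exists a, root p a); last first.
  suff -> : [set z | root p z] = set0 by exact: finite_set0.
  by apply/seteqP; split=> // z pz; case: noroot; exists z.
have [r pE] := factor_theorem _ _ pa.
have r0 : r != 0 by apply: contra_neq p0 => r0; rewrite pE r0 mul0r.
apply: (@sub_finite_set _ _ ([set z | root r z] `|` [set a])).
  by move=> z; rewrite pE /= rootM root_XsubC => /orP[|/eqP]; [left|right].
rewrite finite_setU; split; last exact: finite_set1.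
apply: IH => //; apply: leq_trans szp.
by rewrite pE size_Mmonic ?monicXsubC // size_XsubC addn2.
Qed.

Lemma exceptional_countable : countable exceptional.
Proof.
have -> : exceptional = \bigcup_n
    [set z | if n is 0%N then z = 0 else z ^+ n = 1].
  apply/seteqP; split=> z; first by case=> [->|[[//|n] _ zn]]; [exists 0%N|exists n.+1].
  by case=> -[|n] _ /= zn; [left|right; exists n.+1].
apply: bigcup_countable => // n _; apply: finite_set_countable.
case: n => [|n] /=; first exact: finite_set1.
have sub : [set z : k | z ^+ n.+1 = 1] `<=` [set z | root ('X^(n.+1) - 1) z].
  by move=> z /= zn; rewrite rootE !hornerE zn subrr.
apply: sub_finite_set sub _; apply: finite_roots.
by rewrite -size_poly_gt0 size_XnsubC.
Qed.

Section Nonzero.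
Variable q : k.
Hypothesis gen_q : ~ exceptional q.

Lemma generic_neq0 : q != 0.
Proof. by apply/eqP => q0; apply: gen_q; left. Qed.

Lemma generic_expn n : (0 < n)%N -> q ^+ n != 1.
Proof. by move=> n0; apply/eqP => qn; apply: gen_q; right; exists n. Qed.

Lemma generic_qVq : q * q^-1 = 1.
Proof. exact: mulfV generic_neq0. Qed.

(** The constants that have to be nonzero are built from divisors of q^n - 1. *)
Lemma generic_factor n r s : (0 < n)%N -> r * s = q ^+ n - 1 -> r != 0.
Proof.
move=> n0 rs; apply: contra_neq (generic_expn n0) => r0.
by apply/eqP; rewrite -subr_eq0 -rs r0 mul0r.
Qed.

Lemma generic_q2 : q ^+ 2 + 1 != 0.
Proof. by apply: (@generic_factor 4 _ (q ^+ 2 - 1)) => //; ring. Qed.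

Lemma generic_q4 : q ^+ 4 + 1 != 0.
Proof. by apply: (@generic_factor 8 _ (q ^+ 4 - 1)) => //; ring. Qed.

Lemma generic_uw_cofactor : uw_cofactor q != 0.
Proof.
rewrite mulf_neq0 ?generic_q2 //.
by apply: (@generic_factor 6 _ (q ^+ 2 - 1)) => //; ring.
Qed.

Lemma generic_kappa : kappa q != 0.
Proof. by rewrite mulf_neq0 ?generic_q4 // subr_eq0 generic_expn. Qed.

Lemma generic_be : q + q^-1 != 0.
Proof.
have : q * (q + q^-1) != 0 by rewrite mulrDr generic_qVq -expr2 generic_q2.
by rewrite mulf_eq0 negb_or => /andP[].
Qed.

Lemma generic_al_be : q ^+ 3 + q + (q + q^-1) != 0.
Proof.
have -> : q ^+ 3 + q + (q + q^-1) = (q ^+ 2 + 1) * (q + q^-1).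
  by have qV := generic_qVq; ring: qV.
by rewrite mulf_neq0 ?generic_q2 ?generic_be.
Qed.
End Nonzero.

Lemma generic_not_injective q c (S : {linear 'M[k]_3 -> 'M[k]_3}) :
  c != 0 -> ~ exceptional q -> transposition q S ->
  exists can : {linear cotangent_r q c -> cotangent q c S},
    [/\ forall m, can (cot_r_pi q c m) = cot_pi S (A_tens 1 m),
        forall b x, can (cot_r_mul b x) = cot_mul S (inr b) (can x),
        forall y, exists x, can x = y
      & ~ injective can].
Proof.
move=> c0 gen_q trS; have [x [y [z Sq]]] := transposition_eigen trS.
have z0 := eigen_z_neq0 Sq (bij_inj trS.1).
have qV := generic_qVq gen_q.
have [can canE'] := opquot_lift (@one_tens_Mr _ q c S).
have canE m : can (qpi (@VA_mul _ q c) (@Mr _ q c) m) = one_tens S m := canE' m.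
exists can; split=> [m|b t|t|can_inj].
- exact: canE.
- have [m ->] := qpi_surj t.
  have -> : cot_r_mul b (qpi (@VA_mul _ q c) (@Mr _ q c) m) =
      qpi (@VA_mul _ q c) (@Mr _ q c) (VA_mul b m).
    exact: qopE.
  by rewrite !canE one_tens_mulr.
- by have [m ->] := one_tens_surj t; exists (qpi (@VA_mul _ q c) (@Mr _ q c) m).
pose mu := c / (q ^+ 3 + q + (q + q^-1)).
have mu_c : mu * (q ^+ 3 + q + (q + q^-1)) = c by rewrite mulfVK ?generic_al_be.
have [chi [f [[chi1 chiM chiu chiv _] f_dtens _ f0]]] := cotangent_fibre mu_c.
have ker m : one_tens S m = 0 -> f m = 0.
  by move=> m0; apply/f0/qpi_eq0/can_inj; rewrite canE m0 linear0.
have [p0|p_neq0] := eqVneq (du_coef q y z) 0.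
  have spin2 := obstruction_V2 c Sq.
  have coef : uv_uv q y z * vu_vu q y z != 0.
    apply: contraTneq isT => coef0; have := spin2_coef p0.
    rewrite coef0 mulr0 mulNr => /esym/eqP; rewrite oppr_eq0 mulf_eq0 orbb.
    by rewrite mulf_eq0 (negbTE z0) (negbTE (generic_kappa gen_q)).
  pose m : VA q c :=
    q ^+ 4 *: dtens 0 (gen q c 0 * gen q c 1) - dtens 1 (gen q c 0 * gen q c 0).
  have : one_tens S m = 0.
    move/eqP: spin2; rewrite scaler_eq0 (negbTE coef) /= => /eqP <-.
    by rewrite /m linearB linearZ.
  move/ker; rewrite /m linearB linearZ /= !f_dtens !chiM chiu chiv mulr0 scale0r scaler0 mul1r.
  by move/(congr1 snd)/eqP; rewrite /= sub0r oppr_eq0 scale1r oner_eq0.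
have coef : uw_cofactor q * du_coef q y z * c != 0.
  by apply: mulf_neq0 => //; apply: mulf_neq0 => //; apply: generic_uw_cofactor.
have : one_tens S (dtens 0 1 : VA q c) = 0.
  exact: (scale_cancel coef (obstruction_du c Sq qV)).
move/ker; rewrite f_dtens chi1 scale1r => /(congr1 fst)/eqP.
by rewrite /= (negbTE (generic_be gen_q)).
Qed.
End Generic.

(** * Formal power series *)

Section PowerSeries.
Context {k : fieldType}.
Local Notation K := (pseries k).

(** Multiplication by a series of order n0 acts on coefficients, shifted by n0,
   as an invertible triangular system. *)
Lemma cauchy_eq0 (V : lmodType k) (f : K) (v : pseries V) :
  f != 0 -> cauchy f v = 0 -> v = 0.
Proof.
move=> f0 fv; have exf : exists n, f n != 0.
  apply: contrapT => nf; case/eqP: f0; apply/funext => n.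
  by apply/eqP; apply: contrapT => fn; apply: nf; exists n; apply/negP.
case: (ex_minnP exf) => n0 fn0 minf.
apply/funext => m; elim/ltn_ind: m => m IH.
have lt_n0 : (n0 < (n0 + m).+1)%N by rewrite ltnS leq_addr.
have /eqP : cauchy f v (n0 + m)%N = 0 by rewrite fv.
rewrite /cauchy (bigD1 (Ordinal lt_n0)) //= addKn big1 ?addr0.
  by rewrite scaler_eq0 (negbTE fn0) => /eqP.
move=> [i /= lti] /eqP ni; have {ni} : i != n0 by apply/eqP => e; apply: ni; apply/val_inj.
rewrite neq_ltn => /orP[lt_i|gt_i].
  have -> : f i = 0 by apply/eqP; apply: contraTT lt_i => /minf; rewrite -leqNgt.
  exact: scale0r.
rewrite IH ?scaler0 //; rewrite ltnS in lti.
by rewrite ltn_subLR // ltn_add2r.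
Qed.

Lemma pseries_mul_neq0 (f g : K) : f != 0 -> g != 0 -> f * g != 0.
Proof. by move=> f0; apply: contra_neq; apply: (@cauchy_eq0 k^o). Qed.

Lemma ps_head_mul (f g : K) : (f * g) 0%N = f 0%N * g 0%N.
Proof. by rewrite /GRing.mul /= /ps_mul /cauchy big_ord_recl big_ord0 addr0 subnn. Qed.
Lemma ps_head_add (f g : K) : (f + g) 0%N = f 0%N + g 0%N. Proof. by []. Qed.
Lemma ps_head_opp (f : K) : (- f) 0%N = - f 0%N. Proof. by []. Qed.
Lemma ps_head_1 : (1 : K) 0%N = 1. Proof. by []. Qed.
Lemma ps_head_exp (f : K) n : (f ^+ n) 0%N = f 0%N ^+ n.
Proof. by elim: n => // n IH; rewrite !exprS ps_head_mul IH. Qed.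

Lemma ps_head_neq0 (f : K) : f 0%N != 0 -> f != 0.
Proof. by apply: contra_neq => ->. Qed.

Lemma ps_decomp (f : K) : f = ps_const (f 0%N) + hbar * ((fun n => f n.+1) : K).
Proof.
apply/funext => -[|n]; rewrite [RHS]/GRing.add /= /ps_add.
  by rewrite ps_head_mul mul0r addr0.
rewrite add0r /GRing.mul /= /ps_mul /cauchy 2!big_ord_recl /= /bump /= !subn1.
rewrite /hbar /= scale0r add0r scale1r big1 ?addr0 //= => i _.
by rewrite scale0r.
Qed.
End PowerSeries.

Section ExpHbar.
Context {k : numFieldType}.
Local Notation K := (pseries k).
Local Notation q := (exp_hbar : K).

Lemma exp_hbar_head : q 0%N = 1.
Proof. by rewrite /exp_hbar fact0 invr1. Qed.

(** The inverse is exp(-hbar); the binomial formula for (1 - 1)^n gives the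
   coefficients of the product. *)
Lemma exp_hbarV : q * q^-1 = 1.
Proof.
apply: mulrV; apply: (@ps_unitP _ _ (fun n => (-1) ^+ n / n`!%:R)).
apply/funext => n; rewrite /GRing.mul /= /ps_mul /cauchy.
transitivity (n`!%:R^-1 * \sum_(i < n.+1) (1 ^+ (n - i) * (-1) ^+ i) *+ 'C(n, i) : k).
  rewrite mulr_sumr; apply: eq_bigr => i _; rewrite expr1n mul1r /exp_hbar /GRing.scale /=.
  have fn0 m : m`!%:R != 0 :> k by rewrite pnatr_eq0 -lt0n fact_gt0.
  have le_in : (i <= n)%N by rewrite -ltnS.
  rewrite -[_ *+ 'C(n, i)]mulr_natr -(bin_fact le_in) !natrM.
  have b0 : ('C(n, i)%:R : k) != 0 by rewrite pnatr_eq0 -lt0n bin_gt0.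
  have E (a b d s : k) : a != 0 -> b != 0 -> d != 0 ->
      s / a / b = (d * (a * b))^-1 * (s * d).
    by move=> a0 b0' d0; field; rewrite a0 b0' d0.
  exact: E.
rewrite -exprDn subrr; case: n => [|n]; first by rewrite fact0 invr1 mul1r.
by rewrite expr0n mulr0.
Qed.

Lemma exp_hbarV_head : q^-1 0%N = 1.
Proof.
by have := congr1 (fun f : K => f 0%N) exp_hbarV; rewrite /= ps_head_mul exp_hbar_head mul1r.
Qed.

Lemma exp_hbar_sqr_neq1 : q ^+ 2 - 1 != 0.
Proof.
apply/eqP => /(congr1 (fun f : K => f 1%N)) /eqP.
rewrite /GRing.add /= /ps_add expr2 /GRing.mul /= /ps_mul /cauchy.
rewrite !big_ord_recl big_ord0 /exp_hbar /bump /= !fact0 !factS !fact0.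
rewrite /GRing.scale /= !(invr1, mul1r, addr0) subr0.
by rewrite -mulr2n pnatr_eq0.
Qed.
End ExpHbar.

(** * Completion and flatness *)

Section CompletionMap.
Context {k : fieldType} {M : lmodType (pseries k)} {Om : Type}.
Variable op : Om -> {linear M -> M}.
Local Notation K := (pseries k).
Local Notation h := (hbar : K).

Lemma hpi_eq0 n (x : M) : hpi op n x = 0 <-> exists d, x = h ^+ n *: d.
Proof.
split=> [/qpi_eq0|[d ->]]; last by apply: qpi_gen; exists d.
apply: (op_span_ind (N := [set x | exists d, x = h ^+ n *: d])) => [|y [d _ <-]].
  split=> [|a y y' [d ->] [d' ->]|o y [d ->]].
  - by exists 0; rewrite scaler0.
  - by exists (a *: d + d'); rewrite scalerDr !scalerA mulrC.
  - by exists (op o d); rewrite linearZ.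
by exists d.
Qed.

Program Definition to_completion (m : M) : completion op :=
  @Completion _ _ _ op (fun n => hpi op n m) _.
Next Obligation. by exists m. Qed.

Lemma to_completion_linear : linear to_completion.
Proof. by move=> a x y; apply: completionP => n /=; rewrite linearP. Qed.
HB.instance Definition _ := GRing.isLinear.Build K M (completion op) *:%R
  to_completion to_completion_linear.

Lemma to_completion_op o m : comp_op op o (to_completion m) = to_completion (op o m).
Proof. by apply: completionP => n /=; apply: qopE. Qed.

(** A coherent sequence m_n satisfies m_(n+1) - m_n = hbar^(n+1) d_n, and the
   remainder x' is the series of the hbar^n d_n. *)
Lemma completion_decomp (x : completion op) :
  exists m x', x = to_completion m + h *: x'.
Proof.
have [m mP] := choice (comp_coherent x).
have step n : exists d, m n.+1 - m n = h ^+ n.+1 *: d.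
  apply/hpi_eq0; rewrite linearB; apply/eqP; rewrite subr_eq0; apply/eqP.
  by rewrite -(mP n).2 (mP n.+1).1.
have [d dP] := choice step.
pose s n := \sum_(i < n) h ^+ i *: d i.
have mE n : m n = m 0%N + h *: s n.
  elim: n => [|n IH]; first by rewrite /s big_ord0 scaler0 addr0.
  rewrite -[LHS](subrK (m n)) dP IH /s big_ord_recr /= scalerDr scalerA -exprS.
  by rewrite addrC addrA.
have sP n : exists p, hpi op n (s n) = hpi op n p /\ hpi op n.+1 (s n.+1) = hpi op n.+1 p.
  exists (s n.+1); split=> //; rewrite /s big_ord_recr /= linearD.
  have -> : hpi op n (h ^+ n *: d n) = 0 by apply/hpi_eq0; exists (d n).
  by rewrite addr0.
exists (m 0%N), (@Completion _ _ _ op (fun n => hpi op n (s n)) sP).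
apply: completionP => n.
by rewrite (mP n).1 mE linearD linearZ.
Qed.
End CompletionMap.

Section FlatFibre.
Context {k : fieldType} {Om : Type} {V : lmodType k} {P : lmodType k}
  {T : lmodType (pseries k)}.
Variables (op : Om -> {linear V -> V}) (opT : Om -> {linear T -> T}).
Variables (L : {linear V -> P}) (chi : Om -> k).

(** What flatness contributes: a map defined on the reduction modulo hbar, with
   operators acting through scalars, pulls back to T itself.  It remains onto,
   since T and its completion have the same reduction, and it kills torsion,
   since V[[hbar]] has none. *)
Lemma flat_fibre :
  (forall o v, L (op o v) = chi o *: L v) -> (forall p, exists v, L v = p) ->
  flat_deformation op (comp_op opT) ->
  exists th : T -> P,
    [/\ (forall t t', th (t + t') = th t + th t') /\
          (forall f t, th (f *: t) = f 0%N *: th t),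
        forall o t, th (opT o t) = chi o *: th t,
        forall p, exists t, th t = p
      & forall f t, f != 0 -> f *: t = 0 -> th t = 0].
Proof.
move=> Lop Lsurj [[rho [rho_lin rho_surj rho0 rho_op]] [phi phi_bij]].
pose psi t := L (rho t).
have psi_lin a x y : psi (ps_const a *: x + y) = a *: psi x + psi y.
  by rewrite /psi rho_lin linearP.
have psiD x y : psi (x + y) = psi x + psi y.
  by have := psi_lin 1 x y; rewrite scale1r -[ps_const 1]/(1 : pseries k) scale1r.
have psi_h x : psi (hbar *: x) = 0.
  by rewrite /psi (_ : rho _ = 0) ?linear0 //; apply/rho0; exists x.
have psi0 : psi 0 = 0 by have := psiD 0 0; rewrite addr0 -[LHS]addr0 => /addrI.
have psiZ f x : psi (f *: x) = f 0%N *: psi x.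
  rewrite [f in LHS]ps_decomp scalerDl psiD -scalerA psi_h addr0.
  by have := psi_lin (f 0%N) x 0; rewrite psi0 !addr0.
exists (fun t => psi (to_completion opT t)); split=> [|o t|p|f t f0 ft].
- by split=> [t t'|f t]; rewrite ?linearD ?linearZ /= ?psiD ?psiZ.
- by rewrite -to_completion_op /psi rho_op Lop.
- have [v <-] := Lsurj p; have [x <-] := rho_surj v.
  have [m [x' ->]] := completion_decomp x; exists m.
  by rewrite -[RHS]/(psi _) psiD psi_h addr0.
have -> : to_completion opT t = 0; last exact: psi0.
apply: (bij_inj phi_bij); rewrite linear0; apply: (cauchy_eq0 f0).
have -> : cauchy f (phi (to_completion opT t)) = phi (to_completion opT (f *: t)).
  by rewrite !linearZ.
by rewrite ft !linear0.
Qed.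
End FlatFibre.

(** * The deformation is not flat *)

Section NotFlat.
Context {k : numFieldType}.
Local Notation K := (pseries k).
Local Notation q := (exp_hbar : K).

Lemma exp_hbar_uw_cofactor : uw_cofactor q != 0.
Proof.
apply: ps_head_neq0.
rewrite /uw_cofactor !(ps_head_mul, ps_head_add, ps_head_exp, exp_hbar_head, ps_head_1).
by rewrite !expr1n lt0r_neq0 // mulr_gt0 ?addr_gt0 ?ltr01.
Qed.

Lemma exp_hbar_kappa : kappa q != 0.
Proof.
apply: pseries_mul_neq0; first exact: exp_hbar_sqr_neq1.
apply: ps_head_neq0; rewrite !(ps_head_add, ps_head_exp, exp_hbar_head, ps_head_1).
by rewrite expr1n lt0r_neq0 // addr_gt0 ?ltr01.
Qed.

(** The bimodule is generated by du, dv, dw under right multiplication by letters,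
   which preserves lines of P. *)
Lemma span_generators (c : K) S (P : lmodType k) (th : cotangent q c S -> P)
    (vals : 'I_3 -> k) (p : P) :
  (forall t t', th (t + t') = th t + th t') /\
    (forall f t, th (f *: t) = f 0%N *: th t) ->
  (forall i t, th (cot_mul S (inr (gen q c i)) t) = vals i *: th t) ->
  (forall j, exists a, th (dx S j 1) = a *: p) ->
  forall t, exists a, th t = a *: p.
Proof.
move=> [thD thZ] th_mul th1 t; have [m ->] := one_tens_surj t.
have th0 : th 0 = 0 by rewrite -(scale0r 0) thZ scale0r.
rewrite [m]VA_sum linear_sum.
apply: (big_ind (fun t => exists a, th t = a *: p)) => [|x y [a xa] [b yb]|j _].
- by exists 0; rewrite th0 scale0r.
- by exists (a + b); rewrite thD xa yb scalerDl.
apply: (sphere_ind_mulr (X := fun b => exists a, th (dx S j b) = a *: p))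
  => [r x y [a xa] [b yb]|//|i x [a xa]].
  exists (r 0%N * a + b).
  have -> : dx S j (r *: x + y) = r *: dx S j x + dx S j y by exact: linearP.
  rewrite thD thZ scalerDl -scalerA.
  by apply: (congr2 (fun t t' => r 0%N *: t + t')); [exact: xa|exact: yb].
by exists (vals i * a); rewrite dx_mulr th_mul xa scalerA.
Qed.

Lemma pair_not_line (e : (k^o * k^o)%type) :
  ~ (forall y : (k^o * k^o)%type, exists a : k, y = a *: e).
Proof.
move=> line; have [a [a1 a2]] := line (1, 0); have [b [b1 b2]] := line (0, 1).
have a0 : a != 0 by apply: contra_eq_neq a1 => ->; rewrite scale0r oner_neq0.
have /eqP : e.1 = 0.
  have : b != 0 by apply: contra_eq_neq b2 => ->; rewrite scale0r oner_neq0.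
  by move=> bn; move/esym/eqP: b1; rewrite scaler_eq0 (negbTE bn) => /eqP.
by move/eqP => e1; move/eqP: a1; rewrite e1 scaler0 oner_eq0.
Qed.

Lemma exp_hbar_not_flat (c : k) (S : {linear 'M[K]_3 -> 'M[K]_3}) :
  c != 0 -> transposition q S ->
  ~ flat_deformation (@cot_letter_mul _ 1 c flip)
      (comp_op (@cot_letter_mul _ q (ps_const c) S)).
Proof.
move=> c0 trS flat.
have [x [y [z Sq]]] := transposition_eigen trS.
have z0 := eigen_z_neq0 Sq (bij_inj trS.1).
have two0 : (1 + 1^-1 : k) != 0 by rewrite invr1 -mulr2n pnatr_eq0.
have four0 : (1 ^+ 3 + 1 + (1 + 1^-1) : k) != 0.
  by rewrite invr1 expr1n lt0r_neq0 // !addr_gt0 ?ltr01.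
pose mu := c / (1 ^+ 3 + 1 + (1 + 1^-1)).
have mu0 : mu != 0 by rewrite mulf_neq0 ?invr_eq0.
have mu_c : mu * (1 ^+ 3 + 1 + (1 + 1^-1)) = c by rewrite mulfVK.
have [L [Lop Lgen]] := classical_fibre mu_c.
have Lsurj p : exists v, L v = p.
  have [t0 L0] : exists t, L t = fibre_vec 1 mu 0 by eexists; exact: Lgen.
  have [t1 L1] : exists t, L t = fibre_vec 1 mu 1 by eexists; exact: Lgen.
  exists ((p.1 / (1 + 1^-1)) *: t0 + p.2 *: t1).
  rewrite linearP linearZ /= L0 L1 /fibre_vec /=; case: p => a b /=.
  congr pair; rewrite /= /GRing.scale /= ?mulr0 ?addr0 ?add0r ?mulr1 //.
  by rewrite mulfVK.
have [th [thL th_op th_surj th_tors]] := flat_fibre Lop Lsurj flat.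
have th_mul i t : th (cot_mul S (inr (gen q (ps_const c) i)) t) = gen_value mu i *: th t.
  exact: (th_op (inr i)).
have [thD thZ] := thL.
have th0 : th 0 = 0 by rewrite -(scale0r 0) thZ scale0r.
have th_gen j i : th (dx S j (gen q (ps_const c) i)) = gen_value mu i *: th (dx S j 1).
  by rewrite -[gen _ _ i]mul1r dx_mulr th_mul.
have th_gen1 j i : th (dx S j (gen q (ps_const c) i * 1)) = gen_value mu i *: th (dx S j 1).
  have -> : gen q (ps_const c) i * 1 = gen q (ps_const c) i := mulr1 _.
  exact: th_gen.
have th_gen2 j i l : th (dx S j (gen q (ps_const c) i * gen q (ps_const c) l)) =
    gen_value mu l *: (gen_value mu i *: th (dx S j 1)).
  rewrite dx_mulr; apply: etrans (th_mul _ _) _.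
  by congr (_ *: _); exact: th_gen.
have rel3 a b t0 t1 t2 p0 p1 p2 : a *: t0 + t1 + b *: t2 = 0 ->
    th t0 = p0 -> th t1 = p1 -> th t2 = p2 -> a 0%N *: p0 + p1 + b 0%N *: p2 = 0.
  by move=> e <- <- <-; rewrite -th0 -e !thD !thZ.
have rel2 a t0 t1 p0 p1 : th (a *: t0 - t1) = 0 ->
    th t0 = p0 -> th t1 = p1 -> a 0%N *: p0 - p1 = 0.
  move=> e <- <-; rewrite -[RHS]e thD thZ -scaleN1r; congr (_ + _).
  by rewrite -[- t1]scaleN1r thZ ps_head_opp ps_head_1.
(* The values at du and dw are proportional, by the relation coming from v_0. *)
have v0_eval (p0 p1 p2 : (k^o * k^o)%type) :
    (q ^+ 3 + q) 0%N *: (gen_value mu 2%:R *: p0) + gen_value mu 1 *: p1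
      + (q + q^-1) 0%N *: (gen_value mu 0 *: p2) = 0 -> p2 = - mu *: p0.
  rewrite !(ps_head_add, ps_head_exp, exp_hbar_head, exp_hbarV_head) expr1n.
  rewrite /gen_value /= scale0r addr0 scale1r -scalerDr => /eqP.
  rewrite scaler_eq0 -mulr2n pnatr_eq0 /= addrC addr_eq0 => /eqP ->.
  by rewrite scaleNr.
(* In q^4 du uv - dv uu the first term has value 0, as v has value 0. *)
have spin2_eval a (p0 p1 : (k^o * k^o)%type) :
    a *: (gen_value mu 1 *: (gen_value mu 0 *: p0))
      - gen_value mu 0 *: (gen_value mu 0 *: p1) = 0 -> p1 = 0.
  rewrite /gen_value /= scale0r scaler0 sub0r !scale1r => /eqP.
  by rewrite oppr_eq0 => /eqP.
have th02 : th (dx S 2%:R 1) = - mu *: th (dx S 0 1).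
  exact: v0_eval (rel3 _ _ _ _ _ _ _ _ (dx_v0 S 1)
    (th_gen1 0 2%:R) (th_gen1 1 1) (th_gen1 2%:R 0)).
have self_line (p : (k^o * k^o)%type) : exists a : k, p = a *: p.
  by exists 1; rewrite scale1r.
have zero_line (p e : (k^o * k^o)%type) : p = 0 -> exists a : k, p = a *: e.
  by move=> ->; exists 0; rewrite scale0r.
have [p0|p_neq0] := eqVneq (du_coef q y z) 0.
  have coef : uv_uv q y z * vu_vu q y z != 0.
    apply: contraTneq isT => coef0; have := spin2_coef p0.
    rewrite coef0 mulr0 mulNr => /esym/eqP; rewrite oppr_eq0.
    have zk : z * kappa q != 0 by apply: pseries_mul_neq0 => //; apply: exp_hbar_kappa.
    by rewrite (negbTE (pseries_mul_neq0 zk zk)).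
  have spin2 := th_tors _ _ coef (obstruction_V2 (ps_const c) Sq).
  have th1 : th (dx S 1 1) = 0.
    exact: spin2_eval (rel2 _ _ _ _ _ spin2 (th_gen2 0 0 1) (th_gen2 1 0 0)).
  apply: (@pair_not_line (th (dx S 0 1))) => p; have [t <-] := th_surj p; move: t.
  apply: (span_generators thL th_mul); apply: ord3P.
  - exact: self_line.
  - exact: zero_line.
  - by exists (- mu); exact: th02.
have coef : uw_cofactor q * du_coef q y z * ps_const c != 0.
  apply: pseries_mul_neq0; last exact: ps_head_neq0.
  by apply: pseries_mul_neq0 => //; apply: exp_hbar_uw_cofactor.
have th0' : th (dx S 0 1) = 0 := th_tors _ _ coef (obstruction_du (ps_const c) Sq exp_hbarV).
apply: (@pair_not_line (th (dx S 1 1))) => p; have [t <-] := th_surj p; move: t.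
apply: (span_generators thL th_mul); apply: ord3P.
- exact: zero_line.
- exact: self_line.
- by apply: zero_line; apply: etrans th02 _; apply: etrans (congr1 _ th0') (scaler0 _ _).
Qed.
End NotFlat.

Theorem mainTheorem1 (R : realType) (cplx : bool) (c : ground_field R cplx)
    (c_neq0 : c != 0) :
  (exists E : set (ground_field R cplx),
     [/\ countable E, E 0, (forall z n, (0 < n)%N -> z ^+ n = 1 -> E z)
       & forall q, ~ E q ->
         forall S : {linear 'M[ground_field R cplx]_3 -> 'M[ground_field R cplx]_3},
         transposition q S ->
         exists can : {linear cotangent_r q c -> cotangent q c S},
           [/\ forall m, can (cot_r_pi q c m) = cot_pi S (A_tens 1 m),
               forall b x, can (cot_r_mul b x) = cot_mul S (inr b) (can x),
               forall y, exists x, can x = y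
             & ~ injective can]])
  /\
  (forall S : {linear 'M[pseries (ground_field R cplx)]_3 ->
                      'M[pseries (ground_field R cplx)]_3},
     transposition exp_hbar S ->
     ~ flat_deformation (@cot_letter_mul _ 1 c flip)
         (comp_op (@cot_letter_mul _ exp_hbar (ps_const c) S))).
Proof.
split; last by move=> S; apply: exp_hbar_not_flat.
exists exceptional; split; first exact: exceptional_countable.
- by left.
- by move=> z n n0 zn; right; exists n.
by move=> q gen_q S; apply: generic_not_injective.
Qed.
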